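(* Let $p$ be a prime number and $n\ge 1$. Let a group $G$ have a subnormal series $$G=G_1 \triangleright G_2 \triangleright \ldots \triangleright G_n \triangleright G_{n+1}=\{1\}$$ with factors $B_1,B_2,\dots,B_n$, where $B_i=G_i/G_{i+1}$ are abelian groups and all the factors $B_i$ except $B_n$ (that is, $B_1,\dots,B_{n-1}$) are $p'$-torsion-free. Then there is a group $\hat G\supset G$ with a subnormal series $$\hat G=\hat G_1 \triangleright \hat G_2 \triangleright \ldots \triangleright \hat G_n \triangleright \hat G_{n+1}=\{1\}$$ of the same length $n$, in which all factors $\hat G_i/\hat G_{i+1}$ are abelian and all of them except the last one $\hat G_n/\hat G_{n+1}$ are $p'$-torsion-free, such that any $p$-nonsingular system of equations over $G$ has a solution in $\hat G$. Moreover, $\hat G$ can be chosen so that, in addition, every $p$-nonsingular system of equations over $\hat G$ is solvable in $\hat G$ itself.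
   Context: A group is called $p'$-torsion-free if each of its non-identity elements has either infinite order or order equal to a power of $p$. Systems of equations. Let $G$ be a group and $X=\{x_i\}_{i\in I}$ a (finite or infinite) set of variables; $F(X)$ is the free group with basis $X$. A system of equations over $G$ in variables $X$ is a (finite or infinite) family $\{w_j=1\}_{j\in J}$ with $w_j\in G*F(X)$ (free product). It has a solution in (is solvable in) a group $\tilde G\supset G$ if there are elements $\tilde g_i\in\tilde G$ ($i\in I$) such that substituting $x_i\mapsto\tilde g_i$ (and keeping elements of $G$ fixed) turns every $w_j$ into $1$. The system is called $p$-nonsingular if the images of the words $w_j$, $j\in J$, under the homomorphism $G*F(X)\to\bigoplus_{i\in I}\mathbb Z_p\, x_i$ that sends $G$ to $0$ and each $x_i$ to the basis vector $x_i$ (i.e. the rows of exponent sums of the variables in $w_j$ modulo $p$) form a family linearly independent over $\mathbb Z_p$, where $\mathbb Z_p$ is the field with $p$ elements. *)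

(* Defs.v *)
From HB Require Import structures.
From mathcomp Require Import all_boot all_algebra.
From mathcomp Require Import boolp.
From mathcomp Require Import monalg.

Set Implicit Arguments.
Unset Strict Implicit.
Unset Printing Implicit Defensive.

Import GRing.Theory.

(* A [groupType] may be infinite.  Its carrier, like the index types below, is a
   [choiceType] and its subgroups are boolean predicates; classically neither
   is a restriction. *)

Local Open Scope group_scope.
Local Open Scope quotient_scope.

Notation "{ 'hom' G -> H }" := (UMagmaMorphism.type G H)
  (at level 0, G at level 98, H at level 99, format "{ 'hom'  G  ->  H }")
  : type_scope.

Definition subgroup_of (G : groupType) (H : groupClosed G) : Type :=
  {x : G | x \in H}.

Section SubgroupOf.
Variables (G : groupType) (H : groupClosed G).

Lemma group_closed_mem : group_closed H.
Proof. by split=> [|x y]; [exact: gpred1 | exact: gpredF]. Qed.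

HB.instance Definition _ := [isSub of subgroup_of H for @sval _ _].
HB.instance Definition _ := [Choice of subgroup_of H by <:].
HB.instance Definition _ :=
  @SubChoice_isSubGroup.Build G (mem H) (subgroup_of H) group_closed_mem.

End SubgroupOf.

Definition normal_in (G : groupType) (H N : groupClosed G) : Prop :=
  {subset N <= H} /\ {in N & H, forall x h, x ^ h \in N}.

Section FactorGroup.
Variables (G : groupType) (H N : groupClosed G) (nNH : normal_in H N).

Definition coset_rel : rel (subgroup_of H) :=
  fun x y => val x / val y \in N.

Lemma coset_rel_refl : reflexive coset_rel.
Proof. by move=> x; rewrite /coset_rel divgg gpred1. Qed.

Lemma coset_rel_sym : symmetric coset_rel.
Proof. by move=> x y; rewrite /coset_rel gpredFC. Qed.

Lemma coset_rel_trans : transitive coset_rel.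
Proof.
move=> y x z xy yz; rewrite /coset_rel -(divgKA (val y)).
by rewrite -mulgA; have := gpredM _ _ xy yz; rewrite -!mulgA.
Qed.

Canonical coset_equiv :=
  EquivRel coset_rel coset_rel_refl coset_rel_sym coset_rel_trans.

(* The normality proof only serves to find the group structure. *)
Definition factor_group of normal_in H N : Type := {eq_quot coset_equiv}.

Notation B := (factor_group nNH).

#[hnf] HB.instance Definition _ := EqQuotient.on B.
#[hnf] HB.instance Definition _ := Choice.on B.

Definition factor_mul (x y : B) : B := \pi_B (repr x * repr y).
Definition factor_one : B := \pi_B 1.
Definition factor_inv (x : B) : B := \pi_B (repr x)^-1.

Lemma coset_eqP (x y : subgroup_of H) :
  reflect (\pi_B x = \pi_B y) (val x / val y \in N).
Proof. exact: (@eqmodP _ coset_equiv). Qed.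

Lemma normal_conj (x : G) (h : subgroup_of H) :
  x \in N -> val h * x / val h \in N.
Proof.
move=> xN; have hH : (val h)^-1 \in H by rewrite gpredV; exact: (valP h).
by have := nNH.2 _ _ xN hH; rewrite conjgE invgK mulgA.
Qed.

Lemma pi_factor_mul x y : factor_mul (\pi_B x) (\pi_B y) = \pi_B (x * y).
Proof.
rewrite /factor_mul; case: piP => x' /coset_eqP xx'; case: piP => y' /coset_eqP yy'.
apply/esym/coset_eqP; rewrite !valM invgM mulgA.
have -> : val x * val y / val y' / val x' =
  (val x * (val y / val y') / val x) * (val x / val x').
  by rewrite !mulgA mulgVK.
by rewrite gpredM ?normal_conj.
Qed.

Lemma pi_factor_inv x : factor_inv (\pi_B x) = \pi_B x^-1.
Proof.
rewrite /factor_inv; case: piP => x' /coset_eqP xx'; apply/coset_eqP.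
rewrite !gmulfV /= invgK; have := normal_conj x'^-1 xx'.
by rewrite gmulfV /= invgK !mulgA mulgVK.
Qed.

Lemma factor_mulA : associative factor_mul.
Proof.
move=> x y z; rewrite -[x]reprK -[y]reprK -[z]reprK.
rewrite (pi_factor_mul (repr y)) (pi_factor_mul (repr x) (repr y)).
by rewrite !pi_factor_mul mulgA.
Qed.
Lemma factor_mul1g : left_id factor_one factor_mul.
Proof. by move=> x; rewrite -[x]reprK pi_factor_mul mul1g. Qed.
Lemma factor_mulg1 : right_id factor_one factor_mul.
Proof. by move=> x; rewrite -[x]reprK pi_factor_mul mulg1. Qed.
Lemma factor_mulVg : left_inverse factor_one factor_inv factor_mul.
Proof. by move=> x; rewrite -[x]reprK pi_factor_inv pi_factor_mul mulVg. Qed.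
Lemma factor_mulgV : right_inverse factor_one factor_inv factor_mul.
Proof. by move=> x; rewrite -[x]reprK pi_factor_inv pi_factor_mul mulgV. Qed.

HB.instance Definition _ :=
  isGroup.Build B factor_mulA factor_mul1g factor_mulg1 factor_mulVg factor_mulgV.

Lemma coset_morphM : {morph \pi_B : x y / x * y}.
Proof. by move=> x y; rewrite -[LHS]pi_factor_mul. Qed.

End FactorGroup.

(* The series [term 0 > term 1 > ... > term n], indexed from 0; the values of
   [term] beyond [n] are irrelevant. *)
Record subnormal_series (G : groupType) (n : nat) := SubnormalSeries {
  term : nat -> groupClosed G;
  term_normal : forall i : 'I_n, normal_in (term i) (term i.+1);
  term_first : forall x : G, x \in term 0;
  term_last : forall x : G, (x \in term n) = (x == 1)
}.

Definition factor (G : groupType) (n : nat) (s : subnormal_series G n)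
  (i : 'I_n) : groupType := factor_group (term_normal s i).

Definition abelian_group (B : groupType) : Prop :=
  forall x y : B, commute x y.

Definition has_order (B : groupType) (x : B) (m : nat) : Prop :=
  [/\ (0 < m)%N, x ^+ m = 1 & forall k, (0 < k < m)%N -> x ^+ k <> 1].

Definition infinite_order (B : groupType) (x : B) : Prop :=
  forall m, (0 < m)%N -> x ^+ m <> 1.

Definition p'_torsion_free (p : nat) (B : groupType) : Prop :=
  forall x : B, x <> 1 ->
    infinite_order x \/ exists k, has_order x (p ^ k)%N.

(* The group generated by the letters of [A] subject to the relations
   [u = v] for [R u v], in which moreover [inv_letter a] is the inverse of [a]:
   words modulo the congruence generated by these relations. *)
Section Presentation.
Variables (A : choiceType) (inv_letter : A -> A).
Variable (R : seq A -> seq A -> Prop).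

Inductive word_cong : seq A -> seq A -> Prop :=
| WordRel u v of R u v : word_cong u v
| WordVl a : word_cong [:: inv_letter a; a] [::]
| WordVr a : word_cong [:: a; inv_letter a] [::]
| WordRefl u : word_cong u u
| WordSym u v of word_cong u v : word_cong v u
| WordTrans u v w of word_cong u v & word_cong v w : word_cong u w
| WordCat u u' v v' of word_cong u u' & word_cong v v' :
    word_cong (u ++ v) (u' ++ v').

Definition word_rel : rel (seq A) := fun u v => `[< word_cong u v >].

Lemma word_rel_refl : reflexive word_rel.
Proof. by move=> u; apply/asboolP; exact: WordRefl. Qed.
Lemma word_rel_sym : symmetric word_rel.
Proof. by move=> u v; apply/asboolP/asboolP => /WordSym. Qed.
Lemma word_rel_trans : transitive word_rel.
Proof.
by move=> v u w /asboolP uv /asboolP vw; apply/asboolP; exact: WordTrans vw.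
Qed.

Canonical word_equiv :=
  EquivRel word_rel word_rel_refl word_rel_sym word_rel_trans.

Definition presented_group : Type := {eq_quot word_equiv}.

Notation P := presented_group.

#[hnf] HB.instance Definition _ := EqQuotient.on P.
#[hnf] HB.instance Definition _ := Choice.on P.

Definition inv_word (u : seq A) : seq A := rev (map inv_letter u).

Definition presented_mul (x y : P) : P := \pi_P (repr x ++ repr y).
Definition presented_one : P := \pi_P [::].
Definition presented_inv (x : P) : P := \pi_P (inv_word (repr x)).

Lemma word_eqP (u v : seq A) : (\pi_P u = \pi_P v) <-> word_cong u v.
Proof.
split=> [/(@eqmodP _ word_equiv)/asboolP//|uv].
by apply/(@eqmodP _ word_equiv)/asboolP.
Qed.

Lemma pi_presented_mul u v : presented_mul (\pi_P u) (\pi_P v) = \pi_P (u ++ v).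
Proof.
rewrite /presented_mul; case: piP => u' /word_eqP uu'; case: piP => v' /word_eqP vv'.
by apply/esym/word_eqP; exact: WordCat.
Qed.

Lemma word_mulVg u : word_cong (inv_word u ++ u) [::].
Proof.
elim: u => [|a u IHu]; first exact: WordRefl.
rewrite /inv_word /= rev_cons cat_rcons; apply: WordTrans IHu.
apply: (WordCat (v := [:: inv_letter a; a] ++ u) (v' := [::] ++ u)).
  exact: WordRefl.
apply: WordCat; [exact: WordVl | exact: WordRefl].
Qed.

Lemma word_mulgV u : word_cong (u ++ inv_word u) [::].
Proof.
elim: u => [|a u IHu]; first exact: WordRefl.
rewrite /inv_word /= rev_cons -cats1 catA; apply: WordTrans (WordVr a).
apply: (WordCat (u := [:: a]) (u' := [:: a])
  (v := (u ++ inv_word u) ++ [:: inv_letter a])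
  (v' := [::] ++ [:: inv_letter a])); first exact: WordRefl.
by apply: WordCat => //; exact: WordRefl.
Qed.

Lemma presented_mulA : associative presented_mul.
Proof.
move=> x y z; rewrite -[x]reprK -[y]reprK -[z]reprK.
rewrite (pi_presented_mul (repr y)) (pi_presented_mul (repr x) (repr y)).
by rewrite !pi_presented_mul catA.
Qed.
Lemma presented_mul1g : left_id presented_one presented_mul.
Proof. by move=> x; rewrite -[x]reprK pi_presented_mul. Qed.
Lemma presented_mulg1 : right_id presented_one presented_mul.
Proof. by move=> x; rewrite -[x]reprK pi_presented_mul cats0. Qed.
Lemma presented_mulVg : left_inverse presented_one presented_inv presented_mul.
Proof.
move=> x; rewrite -{2}[x]reprK pi_presented_mul; apply/word_eqP; exact: word_mulVg.
Qed.
Lemma presented_mulgV : right_inverse presented_one presented_inv presented_mul.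
Proof.
move=> x; rewrite -{1}[x]reprK pi_presented_mul; apply/word_eqP; exact: word_mulgV.
Qed.

HB.instance Definition _ := isGroup.Build P presented_mulA presented_mul1g presented_mulg1 presented_mulVg presented_mulgV.

Lemma pi_cat (u v : seq A) : \pi_P (u ++ v) = \pi_P u * \pi_P v.
Proof. by rewrite -pi_presented_mul. Qed.
Lemma pi_nil : \pi_P [::] = 1.
Proof. by []. Qed.

Section Eval.
Variables (K : groupType) (f : A -> K).
Hypothesis fV : forall a, f (inv_letter a) = (f a)^-1.
Hypothesis fR : forall u v, R u v -> \prod_(a <- u) f a = \prod_(a <- v) f a.

Lemma word_cong_prod u v :
  word_cong u v -> \prod_(a <- u) f a = \prod_(a <- v) f a.
Proof.
elim=> {u v} [u v /fR //|a|a|//|//|u v w _ -> _ -> //|u u' v v' _ eu _ ev].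
- by rewrite !big_cons !big_nil fV mulg1 mulVg.
- by rewrite !big_cons !big_nil fV mulg1 mulgV.
- by rewrite !big_cat /= eu ev.
Qed.

Lemma repr_prod u : \prod_(a <- repr (\pi_P u)) f a = \prod_(a <- u) f a.
Proof. by case: piP => v /word_eqP/word_cong_prod. Qed.

Lemma presented_morphF :
  {morph (fun x : P => \prod_(a <- repr x) f a) : x y / x / y}.
Proof.
have mM : {morph (fun x : P => \prod_(a <- repr x) f a) : x y / x * y}.
  move=> x y; rewrite -[x]reprK -[y]reprK.
  by rewrite -pi_cat !repr_prod big_cat.
move=> x y /=; apply: (mulIg (\prod_(a <- repr y) f a)).
by rewrite mulgVK -mM mulgVK.
Qed.

End Eval.

End Presentation.

Section FreeGroup.
Variable X : choiceType.

(* The letters [(x, true)] and [(x, false)] stand for [x] and [x^-1]. *)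
Definition free_group : Type :=
  presented_group (fun a : X * bool => (a.1, ~~ a.2)) (fun _ _ => False).

HB.instance Definition _ := Group.on free_group.

Definition free_gen (x : X) : free_group := \pi_free_group [:: (x, true)].

Variables (K : groupType) (g : X -> K).

Definition free_lift (w : free_group) : K :=
  \prod_(a <- repr w) (if a.2 then g a.1 else (g a.1)^-1).

Lemma free_lift_letterV (a : X * bool) :
  (if (a.1, ~~ a.2).2 then g (a.1, ~~ a.2).1 else (g (a.1, ~~ a.2).1)^-1) =
  (if a.2 then g a.1 else (g a.1)^-1)^-1.
Proof. by case: a => x [] //=; rewrite invgK. Qed.

HB.instance Definition _ := isGroupMorphism.Build free_group K free_lift
  (presented_morphF free_lift_letterV (fun u v => @False_ind _)).

Lemma free_lift_gen x : free_lift (free_gen x) = g x.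
Proof.
by rewrite /free_lift (repr_prod free_lift_letterV) ?big_seq1.
Qed.

End FreeGroup.

Section FreeProduct.
Variables G H : groupType.

Definition free_product_inv (a : G + H) : G + H :=
  match a with inl x => inl x^-1 | inr y => inr y^-1 end.

Inductive free_product_rel : seq (G + H) -> seq (G + H) -> Prop :=
| FreeProd1l : free_product_rel [:: inl 1] [::]
| FreeProd1r : free_product_rel [:: inr 1] [::]
| FreeProdMl x y : free_product_rel [:: inl x; inl y] [:: inl (x * y)]
| FreeProdMr x y : free_product_rel [:: inr x; inr y] [:: inr (x * y)].

Definition free_product : Type :=
  presented_group free_product_inv free_product_rel.

HB.instance Definition _ := Group.on free_product.

Definition free_product_inl (x : G) : free_product := \pi_free_product [:: inl x].
Definition free_product_inr (y : H) : free_product := \pi_free_product [:: inr y].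

Variables (K : groupType) (f : {hom G -> K}) (h : {hom H -> K}).

Let copair (a : G + H) : K := match a with inl x => f x | inr y => h y end.

Definition free_product_lift (w : free_product) : K :=
  \prod_(a <- repr w) match a with inl x => f x | inr y => h y end.

Lemma copairV a : copair (free_product_inv a) = (copair a)^-1.
Proof. by case: a => x /=; rewrite gmulfV. Qed.

Lemma copairR u v : free_product_rel u v ->
  \prod_(a <- u) copair a = \prod_(a <- v) copair a.
Proof.
by case=> [||x y|x y]; rewrite !big_cons ?big_nil /= ?mulg1 ?gmulf1 ?gmulfM.
Qed.

HB.instance Definition _ := isGroupMorphism.Build free_product K
  free_product_lift (presented_morphF copairV copairR).

Lemma free_product_liftl x : free_product_lift (free_product_inl x) = f x.
Proof.
by rewrite /free_product_lift (repr_prod copairV copairR) big_seq1.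
Qed.

Lemma free_product_liftr y : free_product_lift (free_product_inr y) = h y.
Proof.
by rewrite /free_product_lift (repr_prod copairV copairR) big_seq1.
Qed.

End FreeProduct.

(* [equation_word G I] is [G * F(X)] with [X] indexed by [I]; a system of
   equations indexed by [J] is a family [w : J -> equation_word G I]. *)
Definition equation_word (G : groupType) (I : choiceType) : groupType :=
  free_product G (free_group I).

(* [substitute iota g] applies [iota] to the coefficients and sends the i-th
   variable to [g i]. *)
Definition substitute (G K : groupType) (I : choiceType) (iota : {hom G -> K})
  (g : I -> K) : {hom equation_word G I -> K} :=
  free_product_lift iota (free_lift g).

Lemma substitute_coef (G K : groupType) (I : choiceType) (iota : {hom G -> K})
  (g : I -> K) x : substitute iota g (free_product_inl _ x) = iota x.
Proof. exact: free_product_liftl. Qed.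

Lemma substitute_var (G K : groupType) (I : choiceType) (iota : {hom G -> K})
  (g : I -> K) i :
  substitute iota g (free_product_inr _ (free_gen i)) = g i.
Proof. by rewrite /substitute /= free_product_liftr /= free_lift_gen. Qed.

Definition solvable_in (G K : groupType) (iota : {hom G -> K})
    (I J : choiceType) (w : J -> equation_word G I) : Prop :=
  exists g : I -> K, forall j, substitute iota g (w j) = 1.

(* [{malg 'F_p[I]}] is the direct sum of copies of ['F_p] indexed by [I], with
   basis vectors [<< i >>]; only its additive group, written multiplicatively,
   is used here. *)
Definition exponent_group (p : nat) (I : choiceType) : groupType :=
  Algebra.to_multiplicative {malg 'F_p[I]}.

Definition basis_vector (p : nat) (I : choiceType) (i : I) :
  exponent_group p I := (<< i >> : {malg 'F_p[I]})%R.

Definition exponent_vector (p : nat) (G : groupType) (I : choiceType) :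
    {hom equation_word G I -> exponent_group p I} :=
  free_product_lift (@one_fun G (exponent_group p I))
    (free_lift (@basis_vector p I)).

Lemma exponent_vector_coef p (G : groupType) (I : choiceType) (x : G) :
  exponent_vector p G I (free_product_inl _ x) = 1.
Proof. exact: free_product_liftl. Qed.

Lemma exponent_vector_var p (G : groupType) (I : choiceType) (i : I) :
  exponent_vector p G I (free_product_inr _ (free_gen i)) = basis_vector p i.
Proof. by rewrite /exponent_vector /= free_product_liftr /= free_lift_gen. Qed.

Definition linearly_independent (F : fieldType) (V : lmodType F)
    (J : choiceType) (v : J -> V) : Prop :=
  forall (s : seq J) (c : J -> F), uniq s ->
    (\sum_(j <- s) c j *: v j = 0)%R -> forall j, j \in s -> c j = 0%R.

Definition p_nonsingular (p : nat) (G : groupType) (I J : choiceType)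
    (w : J -> equation_word G I) : Prop :=
  linearly_independent
    (fun j => exponent_vector p G I (w j) : {malg 'F_p[I]}).

(* Main.v *)
Require Import Defs.
From HB Require Import structures.
From mathcomp Require Import all_boot all_algebra.
From mathcomp Require Import finmap boolp classical_sets monalg.
From mathcomp Require Import ring.

Set Implicit Arguments.
Unset Strict Implicit.
Unset Printing Implicit Defensive.

Import GRing.Theory.

(* A p-nonsingular system over an abelian group is solvable in every quotient of
   a rational vector space, since independence mod p implies independence over Q;
   this settles n = 1 and, after killing p'-torsion, provides for B_1 = G/G_2 a
   divisible p'-torsion-free D containing it.  By induction G_2 embeds in a group
   H solving its own systems, and by Kaluzhnin-Krasner G embeds in the
   unrestricted wreath product of H by D, which has a series of the same length.
   To solve a system over the wreath product, first solve its image in D; what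
   remains is a system over H whose variables and equations are indexed by
   I x D and J x D.  Its exponent rows are the D-translates of rows W_j over the
   group ring F_p[D] whose augmentations are the original exponent rows, so one
   has to see that augmentations independent over F_p force the W_j to be
   independent over F_p[D].  Through a determinant this reduces to: d in F_p[D]
   with nonzero augmentation is not a zero divisor.  If x d = 0 then
   x d^(p^k) = 0, and as D is p'-torsion-free, for k large a product a b^(p^k)
   with a in supp x and b in supp d determines a; collecting the coefficients
   of those with a given a yields x_a (aug d)^(p^k) = 0. *)

(** * Linear maps on free modules *)

Section MalgLift.
Local Open Scope ring_scope.
Variables (R : nzRingType) (I : choiceType) (M : lmodType R) (f : I -> M).

Definition malg_lift (x : {malg R[I]}) : M := \sum_(i <- msupp x) x@_i *: f i.

(** Any finite set containing the support may index the sum, so several elements can be summed over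
    one common set. *)
Lemma malg_liftEw (d : {fset I}) (x : {malg R[I]}) : fsubset (msupp x) d ->
  malg_lift x = \sum_(i <- d) x@_i *: f i.
Proof.
move=> le_xd; apply: big_fset_incl => // i _ /mcoeff_outdom ->.
by rewrite scale0r.
Qed.

Lemma malg_lift_is_linear : linear malg_lift.
Proof.
move=> c x y; pose d := fsetU (msupp (c *: x + y)) (fsetU (msupp x) (msupp y)).
rewrite (@malg_liftEw d) ?fsubsetUl //.
rewrite (@malg_liftEw d x) ?(@malg_liftEw d y).
- rewrite scaler_sumr -big_split /=; apply: eq_bigr => i _.
  by rewrite mcoeffD mcoeffZ scalerDl scalerA.
- exact: fsubset_trans (fsubsetUr _ _) (fsubsetUr _ _).
- exact: fsubset_trans (fsubsetUl _ _) (fsubsetUr _ _).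
Qed.

HB.instance Definition _ :=
  GRing.isLinear.Build R {malg R[I]} M _ malg_lift malg_lift_is_linear.

Lemma malg_liftU c i : malg_lift << c *g i >> = c *: f i.
Proof.
by rewrite (malg_liftEw msuppU_le) big_seq_fset1 mcoeffUU.
Qed.

End MalgLift.

Section MalgLinear.
Local Open Scope ring_scope.
Variables (R : nzRingType) (I : choiceType).

Lemma malgUZ (c : R) (i : I) : << c *g i >> = c *: << i >> :> {malg R[I]}.
Proof. by apply/malgP => k; rewrite mcoeffZ !mcoeffU mulrnAr mulr1. Qed.

(** A finite family of scalars is the coefficient family of an element of the free module, so
    independence says that [malg_lift v] has trivial kernel. *)
Lemma linearly_independentP (F : fieldType) (V : lmodType F) (v : I -> V) :
  linearly_independent v <-> forall x : {malg F[I]}, malg_lift v x = 0 -> x = 0.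
Proof.
split=> [v_free x vx0 | v_inj s c s_uniq vc0 j j_s].
  apply/malgP => i; rewrite mcoeff0.
  have [i_x|/mcoeff_outdom //] := boolP (i \in msupp x).
  exact: v_free (fset_uniq _) vx0 i i_x.
have := v_inj (\sum_(i <- s) << c i *g i >>); rewrite linear_sum.
have -> : \sum_(i <- s) malg_lift v << c i *g i >> = 0.
  by rewrite -[RHS]vc0; apply: eq_bigr => i _; exact: malg_liftU.
move=> /(_ erefl) /(congr1 (mcoeff j)); rewrite raddf_sum mcoeff0 /=.
rewrite (bigD1_seq j) //= mcoeffUU big1 ?addr0 // => i /negbTE ij.
by rewrite mcoeffU ij.
Qed.

End MalgLinear.

(** * Extension of linear maps from independent families *)

Section LinearExtension.
Local Open Scope ring_scope.
Variables (F : fieldType) (U V : lmodType F).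

(** Graph of a partial linear map. For a set closed under linear combinations, being single-valued
    need only be required at 0. *)
Let linear_graph (A : set (U * V)%type) :=
  (forall c x y, A x -> A y -> A (c *: x + y)) /\
  (forall x, A x -> x.1 = 0 -> x.2 = 0).

Variables (J : choiceType) (a : J -> U) (b : J -> V).

(** Independence makes the assignment of [b j] to [a j] well defined on the span. Zorn's lemma
    extends it to a maximal linear graph, which is total because otherwise a line could be added to
    its domain. *)
Lemma linear_extension : linearly_independent a ->
  exists g : {linear U -> V}, forall j, g (a j) = b j.
Proof.
move=> /linearly_independentP a_free.
pose B0 : set (U * V)%type :=
  fun z => exists x, z = (malg_lift a x, malg_lift b x).
have B0_graph : linear_graph B0.
  split=> [c _ _ [x ->] [y ->]|_ [x ->] /= /a_free ->]; last by rewrite linear0.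
  by exists (c *: x + y); rewrite !linearP.
(* The empty set is admitted because Zorn's lemma also asks for the union of
   the empty chain. *)
pose P (A : set (U * V)%type) := linear_graph A /\ (A = set0 \/ (B0 `<=` A)%classic).
have [] := @Zorn_bigcup _ P.
  move=> C C_P C_chain; split; first split.
  - move=> c x y [A CA Ax] [B CB By].
    have [AB|BA] := C_chain _ _ CA CB.
      by exists B => //; apply: (C_P _ CB).1.1 => //; exact: AB.
    by exists A => //; apply: (C_P _ CA).1.1 => //; exact: BA.
  - by move=> x [A CA Ax]; exact: (C_P _ CA).1.2.
  have [[A [CA A_n0]]|C0] := pselect (exists A, C A /\ A <> set0).
    by right=> z B0z; exists A => //; case: (C_P _ CA).2 => // /(_ _ B0z).
  left; rewrite -subset0 => z [A CA Az]; apply: C0; exists A; split=> // A0.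
  by rewrite A0 in Az.
move=> A [[[A_lin A_fun] A_B0] A_max].
have B0A : (B0 `<=` A)%classic.
  case: A_B0 => // A0; case: (A_max B0); last by split=> //; right.
  rewrite A0; split=> // /(_ (0, 0)); apply.
  by exists 0; rewrite !linear0.
have A0 : A (0, 0) by apply: B0A; exists 0; rewrite !linear0.
have A_tot u : exists v, A (u, v).
  apply: contrapT => u_dom.
  (* Extension of [A] by the line through [u], sent to 0. *)
  pose A' : set (U * V)%type := fun z => exists y c, A y /\ z = (y.1 + c *: u, y.2).
  have AA' : (A `<=` A')%classic.
    by move=> y Ay; exists y, 0; rewrite scale0r addr0 -surjective_pairing.
  apply: (A_max A').
    split=> // /(_ (u, 0)) A'A; apply: u_dom; exists 0; apply: A'A.
    by exists (0, 0), 1; rewrite scale1r add0r.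
  split; last by right; exact: subset_trans AA'.
  split=> [c _ _ [y [d [Ay ->]]] [y' [d' [Ay' ->]]]|].
    exists (c *: y + y'), (c * d + d'); split; first exact: A_lin.
    congr (_, _) => /=.
    by rewrite scalerDl scalerDr -scalerA addrACA.
  move=> _ [y [d [Ay ->]]] /= yu0.
  have [d0|d_n0] := eqVneq d 0.
    by apply: A_fun => //; move: yu0; rewrite d0 scale0r addr0.
  (* Here [y.1] equals [- d *: u], so [u] already lies in the domain of [A]. *)
  case: u_dom; exists (- d^-1 *: y.2).
  have -> : (u, - d^-1 *: y.2) = - d^-1 *: y + (0, 0).
    rewrite addr0; congr (_, _); apply: (scalerI d_n0).
    rewrite scalerA mulrN divff // scaleN1r; apply/esym/eqP.
    by rewrite eqr_oppLR -addr_eq0 yu0.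
  exact: A_lin.
pose g u := projT1 (cid (A_tot u)).
have gP u : A (u, g u) by exact: projT2 (cid (A_tot u)).
have g_uniq u v : A (u, v) -> g u = v.
  move=> Auv; apply/eqP; rewrite -subr_eq0 -[_ - _]/((g u - v)).
  have /A_fun /= := A_lin (-1) _ _ Auv (gP u).
  by rewrite !scaleN1r addNr addrC => ->.
have g_lin : linear g.
  by move=> c u v; apply: g_uniq; exact: (A_lin c _ _ (gP u) (gP v)).
pose gL := GRing.isLinear.Build F U V _ g g_lin.
pose G : {linear U -> V} := HB.pack g gL.
exists G => j; apply: g_uniq; apply: B0A.
by exists << j >>; rewrite !malg_liftU !scale1r.
Qed.

End LinearExtension.

(** * Group rings *)

Lemma malg_ind (R : nzRingType) (I : choiceType) (P : {malg R[I]} -> Prop) :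
  P 0%R -> (forall c x y, P x -> P y -> P (c *: x + y)%R) ->
  (forall i, P << i >>%R) -> forall x, P x.
Proof.
move=> P0 P_lin PU x; rewrite [x]monalgE; elim/big_rec: _ => // i y _ Py.
by rewrite malgUZ; exact: P_lin.
Qed.

(** The proof of commutativity is an argument of the type so that the commutative ring structure,
    required for determinants, can be attached to it. *)
Definition group_ring (F : fieldType) (B : groupType) of abelian_group B : Type :=
  {malg F[B]}.

Section GroupRing.
Local Open Scope ring_scope.
Variables (F : fieldType) (B : groupType) (B_ab : abelian_group B).

Notation A := (group_ring F B_ab).

#[hnf] HB.instance Definition _ := GRing.Lmodule.on A.

Definition group_ring_mul (x y : A) : A :=
  malg_lift (fun b => malg_lift (fun c => << (b * c)%g >> : {malg F[B]}) y) x.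
Definition group_ring_one : A := (<< 1%g >> : {malg F[B]}).

Local Notation mul := group_ring_mul.

Lemma group_ring_mulPl c (x y z : A) : mul (c *: x + y) z = c *: mul x z + mul y z.
Proof. exact: linearP. Qed.

Lemma group_ring_mul0l (z : A) : mul 0 z = 0.
Proof. exact: linear0. Qed.

Lemma group_ring_mulUU b c : mul (<< b >> : {malg F[B]}) (<< c >> : {malg F[B]}) =
  (<< (b * c)%g >> : {malg F[B]}).
Proof. by rewrite /mul !malg_liftU !scale1r. Qed.

Lemma group_ring_mulPr c (x y z : A) : mul x (c *: y + z) = c *: mul x y + mul x z.
Proof.
rewrite /mul /malg_lift scaler_sumr -big_split /=; apply: eq_bigr => b _.
rewrite -!/(malg_lift _ _) (linearP (malg_lift _)) /= scalerDr !scalerA.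
by rewrite (mulrC c).
Qed.

Lemma group_ring_mul0r (x : A) : mul x 0 = 0.
Proof.
rewrite /mul /malg_lift big1 // => b _.
by rewrite -/(malg_lift _ _) linear0 scaler0.
Qed.

Lemma group_ring_mulC : commutative mul.
Proof.
move=> x y; elim/malg_ind: x => [|c x x' IHx IHx'|b].
- by rewrite group_ring_mul0l group_ring_mul0r.
- by rewrite group_ring_mulPl group_ring_mulPr IHx IHx'.
elim/malg_ind: y => [|c y y' IHy IHy'|b'].
- by rewrite group_ring_mul0l group_ring_mul0r.
- by rewrite group_ring_mulPl group_ring_mulPr IHy IHy'.
by rewrite !group_ring_mulUU B_ab.
Qed.

Lemma group_ring_mulA : associative mul.
Proof.
move=> x y z; elim/malg_ind: x => [|c x x' IHx IHx'|b].
- by rewrite !group_ring_mul0l.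
- by rewrite !group_ring_mulPl IHx IHx'.
elim/malg_ind: y => [|c y y' IHy IHy'|b'].
- by rewrite group_ring_mul0r !group_ring_mul0l group_ring_mul0r.
- by rewrite group_ring_mulPl !group_ring_mulPr group_ring_mulPl IHy IHy'.
elim/malg_ind: z => [|c z z' IHz IHz'|b''].
- by rewrite !group_ring_mul0r.
- by rewrite !group_ring_mulPr IHz IHz'.
by rewrite !group_ring_mulUU mulgA.
Qed.

Lemma group_ring_mul1l : left_id group_ring_one mul.
Proof.
elim/malg_ind=> [|c x x' IHx IHx'|b].
- exact: group_ring_mul0r.
- by rewrite group_ring_mulPr IHx IHx'.
by rewrite group_ring_mulUU mul1g.
Qed.

Lemma group_ring_mulDl : left_distributive mul +%R.
Proof. by move=> x y z; rewrite -[x in x + y]scale1r group_ring_mulPl scale1r. Qed.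

Lemma group_ring_one_neq0 : group_ring_one != 0.
Proof.
by apply/eqP => /(congr1 (mcoeff (1%g : B))) /eqP; rewrite mcoeffUU mcoeff0 oner_eq0.
Qed.

HB.instance Definition _ := GRing.Zmodule_isComNzRing.Build A
  group_ring_mulA group_ring_mulC group_ring_mul1l group_ring_mulDl
  group_ring_one_neq0.

Definition gr_elt (b : B) : A := (<< b >> : {malg F[B]}).

Lemma gr_eltM b c : gr_elt (b * c) = gr_elt b * gr_elt c.
Proof. exact/esym/group_ring_mulUU. Qed.

Lemma gr_eltX b n : gr_elt (b ^+ n) = gr_elt b ^+ n.
Proof. by elim: n => // n IHn; rewrite expgS gr_eltM IHn -exprS. Qed.

Lemma scalerAl_gr c (x y : A) : c *: (x * y) = (c *: x) * y.
Proof. by rewrite -[c *: x]addr0 [RHS]group_ring_mulPl group_ring_mul0l addr0. Qed.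

Lemma gr_expand (x : A) :
  x = \sum_(b <- msupp (x : {malg F[B]})) (x : {malg F[B]})@_b *: gr_elt b.
Proof.
by rewrite {1}[x]monalgE; apply: eq_bigr => b _; rewrite malgUZ.
Qed.

Definition augmentation (x : A) : F :=
  malg_lift (fun _ => 1 : F^o) (x : {malg F[B]}).

Lemma augmentation_is_linear : linear_for *%R augmentation.
Proof.
by move=> c x y; exact: (linearP (malg_lift (fun _ : B => 1 : F^o)) c x y).
Qed.

HB.instance Definition _ :=
  GRing.isLinear.Build F A F _ augmentation augmentation_is_linear.

Lemma augmentation_elt b : augmentation (gr_elt b) = 1.
Proof. by rewrite /augmentation malg_liftU scale1r. Qed.

Lemma augmentation_is_monoid_morphism : monoid_morphism augmentation.
Proof.
split; first exact: augmentation_elt.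
move=> x y; elim/malg_ind: x => [|c x x' IHx IHx'|b].
- by rewrite mul0r linear0 mul0r.
- rewrite mulrDl -scalerAl_gr augmentation_is_linear IHx IHx'.
  by rewrite [in RHS]augmentation_is_linear mulrDl mulrA.
elim/malg_ind: y => [|c y y' IHy IHy'|b'].
- by rewrite mulr0 linear0 mulr0.
- rewrite mulrC mulrDl -scalerAl_gr augmentation_is_linear !(mulrC _ (gr_elt b)).
  by rewrite IHy IHy' [in RHS]augmentation_is_linear mulrDr !mulrA (mulrC c).
by rewrite -[LHS]/(augmentation (gr_elt b * gr_elt b')) -gr_eltM !augmentation_elt mulr1.
Qed.

HB.instance Definition _ := GRing.isMonoidMorphism.Build A F augmentation
  augmentation_is_monoid_morphism.

Variable p : nat.
Hypothesis B_ptf : forall (x : B) m, coprime m p -> (x ^+ m = 1 -> x = 1)%g.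

(** For u <> 1 at most one k satisfies v^(p^k) = u: two such exponents k0 < k give u^(p^(k - k0) -
    1) = 1, with an exponent prime to p. A finite list therefore rules out only finitely many k. *)
Lemma eventually_not_pth_power (p_prime : prime p) (L : seq (B * B)) :
  exists K, forall k, (K <= k)%N ->
    forall u v, (u, v) \in L -> (v ^+ (p ^ k) = u -> u = 1)%g.
Proof.
elim: L => [|[u v] L [K KP]]; first by exists 0%N.
have [[k0 [k0K k0P u_n1]]|no_k] := pselect (exists k0, [/\ (K <= k0)%N,
    (v ^+ (p ^ k0) = u)%g & (u <> 1)%g]).
  exists k0.+1 => k k0k u' v'; rewrite inE => /predU1P[[-> ->] kP|]; last first.
    by move=> uvL; apply: KP (uvL); exact: leq_trans (ltnW k0k).
  case: u_n1; rewrite -k0P; apply: (B_ptf (m := p ^ (k - k0) - 1)).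
    rewrite coprime_sym prime_coprime //; apply/negP => p_dvd.
    have := dvdn_exp (k := k - k0) _ (dvdnn p); rewrite subn_gt0 k0k => /(_ isT).
    rewrite -(subnK (_ : 1 <= p ^ (k - k0))%N) ?expn_gt0 ?prime_gt0 //.
    by rewrite dvdn_addr // Euclid_dvd1.
  rewrite expgnFr ?expn_gt0 ?prime_gt0 // -expgnA -expnD subnKC ?(ltnW k0k) //.
  by rewrite kP k0P divgg.
exists K => k Kk u' v'; rewrite inE => /predU1P[[-> ->] kP|]; last exact: KP.
by apply: contrapT => u1; apply: no_k; exists k.
Qed.

Hypothesis p_char : p \in [pchar F].

Lemma gr_pchar : p \in [pchar A].
Proof.
move: p_char; rewrite !inE => /andP[-> /eqP p0] /=.
by rewrite -scaler_nat p0 scale0r.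
Qed.

(** In characteristic p, raising to the power p^k is additive on a commutative ring, so it can be
    done term by term. *)
Lemma gr_Frobenius (x : A) k :
  x ^+ (p ^ k) = \sum_(b <- msupp (x : {malg F[B]}))
    ((x : {malg F[B]})@_b) ^+ (p ^ k) *: gr_elt (b ^+ (p ^ k))%g.
Proof.
have p_prime : prime p by move: p_char; rewrite !inE => /andP[].
have pk_gt0 : (0 < p ^ k)%N by rewrite expn_gt0 prime_gt0.
have pk_nat : [pchar A].-nat (p ^ k)%N.
  by rewrite pnatX (pnatE _ p_prime) gr_pchar.
have DX : {morph (fun y : A => y ^+ (p ^ k)) : y z / y + z}.
  by move=> y z /=; exact: exprDn_pchar.
rewrite {1}[x]gr_expand (big_morph _ DX (id1 := 0)) ?expr0n -?lt0n ?gtn_eqF //.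
apply: eq_bigr => b _; rewrite gr_eltX.
have ZX n c (y : A) : (c *: y) ^+ n = c ^+ n *: y ^+ n.
  elim: n => [|n IHn]; first by rewrite !expr0 scale1r.
  rewrite !exprS IHn -scalerAl_gr [y * _]mulrC -scalerAl_gr scalerA.
  by rewrite [y * _]mulrC.
exact: ZX.
Qed.

Lemma group_ring_nzd (x d : A) : augmentation d != 0 -> x * d = 0 -> x = 0.
Proof.
move=> d_n0 xd0; have p_prime : prime p by move: p_char; rewrite !inE => /andP[].
pose X := msupp (x : {malg F[B]}); pose Y := msupp (d : {malg F[B]}).
pose f (u v : B * B) := ((u.2 / u.1)%g, (v.2 / v.1)%g).
(* A coincidence a' b^q = a b'^q with q = p^k makes a'/a the q-th power of b'/b, so [L] lists all
   such pairs of quotients. *)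
pose L := [seq f u v | u <- [seq (a, a') | a <- X, a' <- X],
                       v <- [seq (b, b') | b <- Y, b' <- Y]].
have [k /(_ k (leqnn k)) kP] := eventually_not_pth_power p_prime L.
set q := (p ^ k)%N in kP.
have aq_inj a a' b b' : a \in X -> a' \in X -> b \in Y -> b' \in Y ->
    (a' * b ^+ q = a * b' ^+ q)%g -> a' = a.
  move=> aX a'X bY b'Y e; apply: divg1_eq; apply: (kP _ (b' / b)%g).
    exact: (allpairs_f f (allpairs_f pair aX a'X) (allpairs_f pair bY b'Y)).
  rewrite expgnFl; last exact: B_ab.
  apply/eqP; rewrite divg_eq; apply/eqP; apply: (mulgI a).
  by rewrite -e !mulgA [(a * a')%g]B_ab mulgK.
apply/malgP => a; rewrite mcoeff0.
have [aX|/mcoeff_outdom //] := boolP (a \in X).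
pose Z := [seq (a * b ^+ q)%g | b <- Y].
(* [T] adds up the coefficients over the whole of [Z], since distinct elements b may have the same
   q-th power. By [aq_inj] only the terms of [x * d ^+ q] coming from [a] fall in [Z]. *)
pose T : {linear {malg F[B]} -> F^o} := malg_lift (fun z => (z \in Z)%:R).
have xdq0 : x * d ^+ q = 0.
  by rewrite -[q]prednK ?expn_gt0 ?prime_gt0 // exprS mulrA xd0 mul0r.
have : T (x * d ^+ q) = x@_a * augmentation d ^+ q.
  rewrite {1}[x]gr_expand gr_Frobenius mulr_suml.
  under eq_bigr => a' _ do rewrite mulr_sumr.
  rewrite linear_sum (big_fsetD1 a) //= [X in _ + X]big_seq_cond [X in _ + X]big1 ?addr0.
    under eq_bigr => b _ do
      rewrite -scalerAl_gr mulrC -scalerAl_gr mulrC scalerA -gr_eltM.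
    rewrite linear_sum; transitivity (\sum_(b <- Y) x@_a * (d@_b) ^+ q).
      apply: eq_big_seq => b bY; rewrite linearZ /= malg_liftU scale1r.
      have -> : (a * b ^+ q \in Z)%g by apply/mapP; exists b.
      exact: mulr1.
    rewrite -mulr_sumr [in RHS](_ : augmentation d = \sum_(b <- Y) d@_b); last first.
      by rewrite /augmentation /malg_lift; apply: eq_bigr => b _; exact: mulr1.
    have pF_nat : [pchar F].-nat q by rewrite pnatX (pnatE _ p_prime) p_char.
    rewrite (big_morph (fun y => y ^+ q)
      (fun y z => exprDn_pchar y z pF_nat) (id1 := 0)) //.
    by rewrite expr0n gtn_eqF // expn_gt0 prime_gt0.
  move=> a' /andP[]; rewrite in_fsetD1 => /andP[a'a a'X] _.
  under eq_bigr => b _ do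
    rewrite -scalerAl_gr mulrC -scalerAl_gr mulrC scalerA -gr_eltM.
  rewrite linear_sum big_seq big1 // => b bY; rewrite linearZ /= malg_liftU scale1r.
  have /negbTE -> : (a' * b ^+ q \notin Z)%g.
    by apply: contra a'a => /mapP[b' b'Y /aq_inj ->].
  exact: mulr0.
rewrite xdq0 linear0 => /esym/eqP; rewrite mulf_eq0 => /orP[/eqP //|].
by rewrite expf_eq0 (negbTE d_n0) andbF.
Qed.

(* A right inverse over [F] of the augmented matrix turns [W] into a square
   matrix whose determinant has augmentation 1. *)
Lemma group_ring_row_free r m (W : 'M[A]_(r, m)) (c : 'rV[A]_r) :
  row_free (map_mx augmentation W) -> c *m W = 0 -> c = 0.
Proof.
move=> /row_freeP[N WN1] cW0.
pose N' : 'M[A]_(m, r) := map_mx (fun t : F => t *: (1 : A) : A) N.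
have N'N : map_mx augmentation N' = N.
  by apply/matrixP => i j; rewrite !mxE linearZ /= rmorph1 mulr1.
pose U := W *m N'.
have detU1 : augmentation (\det U) = 1.
  by rewrite -det_map_mx map_mxM N'N WN1 det1.
have : c *m (U *m \adj U) = 0 by rewrite mulmxA /U (mulmxA c) cW0 !mul0mx.
rewrite mul_mx_adj mul_mx_scalar => /matrixP cU; apply/matrixP => i j.
rewrite mxE; apply: (@group_ring_nzd _ (\det U)); first by rewrite detU1 oner_neq0.
by have := cU i j; rewrite !mxE mulrC.
Qed.

End GroupRing.

(** * Independence of translates over the group ring *)

Section TranslateIndependence.
Local Open Scope ring_scope.
Variables (F : fieldType) (B : groupType) (B_ab : abelian_group B).
Variables (p : nat) (p_char : p \in [pchar F]).
Hypothesis B_ptf : forall (x : B) m, coprime m p -> (x ^+ m = 1 -> x = 1)%g.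

Notation A := (group_ring F B_ab).

(** The free F-module on [I * B] is the free module on [I] over the group ring: [component i] is the
    i-th coordinate, [translate q] is multiplication by the group element [q], and [fiber_sum] is
    the coordinatewise augmentation. *)
Definition translate (I : choiceType) (q : B) :
    {malg F[(I * B)%type]} -> {malg F[(I * B)%type]} :=
  malg_lift (fun z => << (z.1, (q * z.2)%g) >>).
HB.instance Definition _ I q := GRing.Linear.on (@translate I q).

Definition fiber_sum (I : choiceType) : {malg F[(I * B)%type]} -> {malg F[I]} :=
  malg_lift (fun z => << z.1 >>).
HB.instance Definition _ I := GRing.Linear.on (@fiber_sum I).

Definition component (I : choiceType) (i : I) : {malg F[(I * B)%type]} -> A :=
  malg_lift (fun z => if z.1 == i then gr_elt F B_ab z.2 else 0).
HB.instance Definition _ I i := GRing.Linear.on (@component I i).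

Section Theory.
Variable I : choiceType.
Implicit Types (i : I) (w : {malg F[(I * B)%type]}).

Lemma translateP q c x w : translate q (c *: x + w) = c *: translate q x + translate q w.
Proof. exact: linearP. Qed.

Lemma fiber_sumP c x w : fiber_sum (c *: x + w) = c *: fiber_sum x + fiber_sum w.
Proof. exact: linearP. Qed.

Lemma componentP i c x w : component i (c *: x + w) = c *: component i x + component i w.
Proof. exact: linearP. Qed.

Lemma componentU i z :
  component i << z >> = if z.1 == i then gr_elt F B_ab z.2 else 0.
Proof. by rewrite /component malg_liftU scale1r. Qed.

Lemma component_translate i q w :
  component i (translate q w) = gr_elt F B_ab q * component i w.
Proof.
elim/malg_ind: w => [|c x y IHx IHy|z]; first by rewrite !linear0 mulr0.
  rewrite translateP !componentP IHx IHy mulrDr.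
  by rewrite [X in _ = X + _]mulrC -scalerAl_gr (mulrC (component i x)).
rewrite /translate malg_liftU scale1r !componentU /=.
by case: eqP => _; rewrite ?mulr0 // gr_eltM.
Qed.

Lemma augmentation_component i w :
  augmentation (component i w) = (fiber_sum w)@_i.
Proof.
elim/malg_ind: w => [|c x y IHx IHy|z]; first by rewrite !linear0 mcoeff0.
  rewrite componentP augmentation_is_linear IHx IHy fiber_sumP.
  by rewrite mcoeffD mcoeffZ.
rewrite /fiber_sum malg_liftU scale1r componentU mcoeffU.
by case: eqP => _; rewrite ?linear0 ?augmentation_elt.
Qed.

Lemma mcoeff_component i w b : (component i w : {malg F[B]})@_b = w@_(i, b).
Proof.
elim/malg_ind: w => [|c x y IHx IHy|[j d]]; first by rewrite linear0 !mcoeff0.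
  by rewrite componentP [LHS]mcoeffD [in LHS]mcoeffZ IHx IHy mcoeffD mcoeffZ.
rewrite componentU mcoeffU xpair_eqE /=.
by case: eqP => _; rewrite ?mcoeff0 // [LHS]mcoeffU.
Qed.

End Theory.

Lemma linearly_independent_ord (V : lmodType F) (J : choiceType) (v : J -> V)
    r (t : 'I_r -> J) (c : 'I_r -> F) :
  linearly_independent v -> injective t ->
  \sum_a c a *: v (t a) = 0 -> forall a, c a = 0.
Proof.
move=> /linearly_independentP v_free t_inj cv0 a.
have := v_free (\sum_a << c a *g t a >>); rewrite linear_sum.
under eq_bigr => i _ do rewrite /= malg_liftU.
move=> /(_ cv0) /(congr1 (mcoeff (t a))); rewrite raddf_sum mcoeff0 /=.
rewrite (bigD1 a) //= mcoeffUU big1 ?addr0 // => i ia.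
by rewrite mcoeffU (inj_eq t_inj) (negbTE ia).
Qed.

Variables (I J : choiceType) (w : J -> {malg F[(I * B)%type]}).

(** A linear relation [x] among the translates is a relation among the [w j] over the group ring,
    with coefficients [component j x]. Restricted to finitely many rows and columns it becomes a
    matrix relation, to which [group_ring_row_free] applies. *)
Lemma translates_independent :
  linearly_independent (fun j => fiber_sum (w j)) ->
  linearly_independent (fun z : J * B => translate z.2 (w z.1)).
Proof.
move=> w_free; apply/linearly_independentP => x x0.
pose s := undup [seq z.1 | z <- msupp x].
(* Outside these columns every augmented row indexed by [s] vanishes, so restricting to them keeps
   the augmented rows independent. *)
pose cols := undup (flatten [seq (msupp (fiber_sum (w j)) : seq I) | j <- s]).
have comp_s z : z \in msupp x -> z.1 \in s by move=> zx; rewrite mem_undup map_f.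
have xw0 i : \sum_(j <- s) component j x * component i (w j) = 0.
  rewrite -[RHS](linear0 (@component I i)) -x0 /malg_lift linear_sum.
  rewrite (eq_bigr (fun j => \sum_(z <- msupp x) x@_z *:
      ((if z.1 == j then gr_elt F B_ab z.2 else 0) * component i (w j)))); last first.
    move=> j _; rewrite {1}/component /malg_lift mulr_suml.
    by apply: eq_bigr => z _; rewrite scalerAl_gr.
  rewrite exchange_big /=; apply: eq_big_seq => z zx.
  rewrite linearZ /= component_translate -scaler_sumr; congr (_ *: _).
  rewrite (bigD1_seq z.1) ?comp_s ?undup_uniq //= eqxx big1 ?addr0 // => j.
  by rewrite eq_sym => /negbTE ->; rewrite mul0r.
pose sj := tnth (in_tuple s); pose ci := tnth (in_tuple cols).
pose W : 'M[A]_(size s, size cols) := \matrix_(a, l) component (ci l) (w (sj a)).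
have W_free : row_free (map_mx (@augmentation _ _ B_ab) W).
  apply: inj_row_free => v vW0; apply/rowP => a; rewrite mxE.
  apply: (linearly_independent_ord w_free (t := sj) (c := v 0)).
    by apply/tuple_uniqP; exact: undup_uniq.
  apply/malgP => i; rewrite raddf_sum mcoeff0 /=.
  have [/(tnthP (in_tuple cols))[l il]|iNcols] := boolP (i \in cols).
    move/rowP: vW0 => /(_ l); rewrite !mxE => vW0; rewrite -[RHS]vW0.
    apply: eq_bigr => a' _; rewrite !mxE mcoeffZ augmentation_component.
    by rewrite il.
  rewrite big1 // => a' _; rewrite mcoeffZ [X in _ * X]mcoeff_outdom ?mulr0 //.
  apply: contra iNcols => i_supp; rewrite mem_undup; apply/flattenP.
  exists (msupp (fiber_sum (w (sj a'))) : seq I) => //.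
  by apply: map_f; exact: mem_tnth.
have x_row0 := group_ring_row_free B_ptf p_char W_free
  (c := \row_a component (sj a) x).
apply/malgP => -[j b]; rewrite mcoeff0.
have [jb_x|/mcoeff_outdom //] := boolP ((j, b) \in msupp x).
rewrite -mcoeff_component.
have /(tnthP (in_tuple s))[a /= ->] := comp_s _ jb_x.
have cW0 : (\row_a component (sj a) x) *m W = 0.
  apply/rowP => l; rewrite !mxE; rewrite -[RHS](xw0 (ci l)) [RHS]big_tnth.
  by apply: eq_bigr => a' _; rewrite !mxE.
by move/rowP: (x_row0 cW0) => /(_ a); rewrite !mxE => ->; exact: mcoeff0.
Qed.

End TranslateIndependence.

(** * Words and subgroups *)

Section WordInduction.
Local Open Scope quotient_scope.
Local Open Scope group_scope.

Section FreeProductMaps.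
Variables G H : groupType.

Lemma free_product_inlM : {morph @free_product_inl G H : x y / x * y}.
Proof.
move=> x y; rewrite /free_product_inl -pi_cat; apply/word_eqP/WordSym/WordRel.
exact: FreeProdMl.
Qed.

Lemma free_product_inl1 : @free_product_inl G H 1 = 1.
Proof. by apply/word_eqP/WordRel; exact: FreeProd1l. Qed.

HB.instance Definition _ := isUMagmaMorphism.Build G (free_product G H)
  (@free_product_inl G H) (conj free_product_inl1 free_product_inlM).

Lemma free_product_inrM : {morph @free_product_inr G H : x y / x * y}.
Proof.
move=> x y; rewrite /free_product_inr -pi_cat; apply/word_eqP/WordSym/WordRel.
exact: FreeProdMr.
Qed.

Lemma free_product_inr1 : @free_product_inr G H 1 = 1.
Proof. by apply/word_eqP/WordRel; exact: FreeProd1r. Qed.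

HB.instance Definition _ := isUMagmaMorphism.Build H (free_product G H)
  (@free_product_inr G H) (conj free_product_inr1 free_product_inrM).

End FreeProductMaps.

Lemma free_group_ind (X : choiceType) (P : free_group X -> Prop) :
  P 1 -> (forall u v, P u -> P v -> P (u * v)) -> (forall u, P u -> P u^-1) ->
  (forall x, P (free_gen x)) -> forall u, P u.
Proof.
move=> P1 PM PV Pgen u; rewrite -[u]reprK; elim: (repr u) => [|a s IHs].
  exact: P1.
rewrite -cat1s [X in P X]pi_cat; apply: (PM _ _ _ IHs).
case: a => x []; first exact: Pgen.
rewrite [X in P X](_ : _ = (free_gen x)^-1); first exact: PV.
apply: (mulIg (free_gen x)); rewrite mulVg; rewrite -[LHS]pi_cat.
by apply/word_eqP; exact: (@WordVl _ _ _ (x, true)).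
Qed.

Section EquationWord.
Variables (G : groupType) (I : choiceType).
Notation W := (equation_word G I).

Definition coef_word : {hom G -> W} := @free_product_inl G (free_group I).
Definition var_word (i : I) : W := free_product_inr G (free_gen i).

Lemma equation_word_ind (P : W -> Prop) :
  P 1 -> (forall u v, P u -> P v -> P (u * v)) -> (forall u, P u -> P u^-1) ->
  (forall g, P (coef_word g)) -> (forall i, P (var_word i)) -> forall u, P u.
Proof.
move=> P1 PM PV Pc Px u; rewrite -[u]reprK; elim: (repr u) => [|a s IHs].
  exact: P1.
rewrite -cat1s [X in P X]pi_cat; apply: (PM _ _ _ IHs); case: a => [g|y].
  exact: Pc.
rewrite -[X in P X]/(free_product_inr G y); elim/free_group_ind: y => [|u' v'|u'|i].
- by rewrite gmulf1.
- by rewrite gmulfM => *; exact: PM.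
- by rewrite gmulfV => *; exact: PV.
exact: Px.
Qed.

Lemma equation_word_ext (K : groupType) (f h : {hom W -> K}) :
  (forall g, f (coef_word g) = h (coef_word g)) ->
  (forall i, f (var_word i) = h (var_word i)) -> f =1 h.
Proof.
move=> fh_c fh_v; elim/equation_word_ind => [|u v|u|g|i] //.
- by rewrite !gmulf1.
- by rewrite !gmulfM => -> ->.
by rewrite !gmulfV => ->.
Qed.

(** Both sides are homomorphisms that agree on the coefficients and on the variables. This one
    principle compares exponent vectors, expansions and solutions under a change of target group. *)
Lemma substitute_comp (K L : groupType) (iota : {hom G -> K}) (g : I -> K)
    (phi : {hom K -> L}) (iota' : {hom G -> L}) (g' : I -> L) :
  (forall x, phi (iota x) = iota' x) -> (forall i, phi (g i) = g' i) ->
  forall u, phi (substitute iota g u) = substitute iota' g' u.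
Proof.
move=> phi_c phi_v.
apply: (equation_word_ext (f := phi \o substitute iota g)) => [x|i] /=.
  by rewrite !substitute_coef.
by rewrite !substitute_var.
Qed.

(** Exponent vectors are themselves values of a substitution with trivial coefficients, so
    [substitute_comp] applies to them. *)
Lemma exponent_vectorE p u :
  exponent_vector p G I u = substitute (@one_fun G _) (@basis_vector p I) u.
Proof. by []. Qed.

End EquationWord.

End WordInduction.

Section PredicateSubgroup.
Local Open Scope group_scope.
Variables (G : groupType) (P : G -> Prop).
Hypotheses (P1 : P 1) (PM : forall x y, P x -> P y -> P (x * y)).
Hypothesis PV : forall x, P x -> P x^-1.

Definition prop_pred : {pred G} := fun x => `[< P x >].

Lemma prop_pred_mul : mulg_closed prop_pred.
Proof. by move=> x y /asboolP Px /asboolP Py; apply/asboolP/PM. Qed.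

Lemma prop_pred_one : 1 \in prop_pred.
Proof. exact/asboolP. Qed.

Lemma prop_pred_inv : invg_closed prop_pred.
Proof. by move=> x /asboolP Px; apply/asboolP/PV. Qed.

Definition prop_subgroup : groupClosed G :=
  HB.pack prop_pred (isMulClosed.Build G prop_pred prop_pred_mul)
    (isMul1Closed.Build G prop_pred prop_pred_one)
    (isInvClosed.Build G prop_pred prop_pred_inv).

Lemma in_prop_subgroup x : reflect (P x) (x \in prop_subgroup).
Proof. exact: asboolP. Qed.

End PredicateSubgroup.

Section QuotientMap.
Local Open Scope group_scope.
Variables (G : groupType) (H N : groupClosed G) (nNH : normal_in H N).
Hypothesis H_full : forall x, x \in H.

(** Elements of [factor_group] are classes of [subgroup_of H]; when [H] is everything, as for the
    first term of a series, the projection can start from [G] itself. *)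
Definition quotient_map (x : G) : factor_group nNH :=
  (\pi_(factor_group nNH) (exist _ x (H_full x) : subgroup_of H))%qT.

Lemma quotient_mapM : {morph quotient_map : x y / x * y}.
Proof.
move=> x y; rewrite /quotient_map -coset_morphM; congr (\pi_ _)%qT.
exact: val_inj.
Qed.

Lemma quotient_map_eq x y : (quotient_map x = quotient_map y) <-> x / y \in N.
Proof. by split=> [/coset_eqP|xy]; last apply/coset_eqP. Qed.

Lemma quotient_map1 : quotient_map 1 = 1.
Proof. by apply/coset_eqP; rewrite /= divgg gpred1. Qed.

HB.instance Definition _ := isUMagmaMorphism.Build G (factor_group nNH)
  quotient_map (conj quotient_map1 quotient_mapM).

Lemma quotient_map_surj y : exists x, quotient_map x = y.
Proof.
exists (val (repr y)); rewrite -[RHS]reprK; congr (\pi_ _)%qT; exact: val_inj.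
Qed.

Lemma quotient_map_eq1 x : (quotient_map x = 1) <-> x \in N.
Proof. by rewrite -quotient_map1 quotient_map_eq divg1. Qed.

End QuotientMap.

(** * Divisible abelian groups *)

Section IntegralCombinations.
Local Open Scope ring_scope.
Variable (I : choiceType).

(** Coefficientwise image of an integral vector: reduction mod p for ['F_p], inclusion for [rat].
    The tag [zmodule] views the target as a module over the integers. *)
Definition malg_of_int (R : nzRingType) : {malg int[I]} -> {malg R[I]} :=
  malg_lift (fun i => (<< i >> : zmodule {malg R[I]})).

Lemma malg_of_int_is_additive R : {morph @malg_of_int R : x y / x - y}.
Proof.
move=> x y.
exact: (linearB (malg_lift (fun i : I => (<< i >> : zmodule {malg R[I]}))) x y).
Qed.

HB.instance Definition _ (R : nzRingType) :=
  GRing.isZmodMorphism.Build {malg int[I]} {malg R[I]}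
  (@malg_of_int R) (@malg_of_int_is_additive R).

Lemma malg_of_intP (R : nzRingType) c x y :
  malg_of_int R (c *: x + y) = malg_of_int R x *~ c + malg_of_int R y.
Proof.
exact: (linearP (malg_lift (fun i : I => (<< i >> : zmodule {malg R[I]}))) c x y).
Qed.

Lemma malg_of_intE (R : nzRingType) x i : (malg_of_int R x)@_i = (x@_i)%:~R.
Proof.
elim/malg_ind: x => [|c x y IHx IHy|j].
- by rewrite raddf0 !mcoeff0.
- rewrite malg_of_intP mcoeffD raddfMz /= IHx IHy mcoeffD mcoeffZ intrD.
  by rewrite mulrC intrM -mulrzr.
by rewrite /malg_of_int malg_liftU scale1r !mcoeffU; case: (j == i).
Qed.

Lemma malg_of_intU (R : nzRingType) i : malg_of_int R << i >> = << i >>.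
Proof. by rewrite /malg_of_int malg_liftU scale1r. Qed.

Lemma malg_of_intZ (R : nzRingType) c x :
  malg_of_int R (c *: x) = c%:~R *: malg_of_int R x.
Proof. by apply/malgP => i; rewrite mcoeffZ !malg_of_intE mcoeffZ intrM. Qed.

Lemma malg_of_int_inj (R : numDomainType) : injective (malg_of_int R).
Proof.
move=> x y /malgP xy; apply/malgP => i.
by have := xy i; rewrite !malg_of_intE => /intr_inj.
Qed.

End IntegralCombinations.

(** * From independence mod p to independence over Q *)

Section IntegralIndependence.
Local Open Scope ring_scope.
Variables (I J : choiceType) (a : J -> {malg int[I]}).

Lemma malg_of_int_lift (R : nzRingType) c : malg_of_int R (malg_lift a c) =
  malg_lift (fun j => malg_of_int R (a j)) (malg_of_int R c).
Proof.
elim/malg_ind: c => [|c x y IHx IHy|j].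
- by rewrite !raddf0.
- rewrite (linearP (malg_lift a)) /= !malg_of_intP IHx IHy.
  by rewrite [in RHS]raddfD raddfMz.
by rewrite malg_of_intU !malg_liftU !scale1r.
Qed.

Lemma malg_common_denominator (x : {malg rat[J]}) :
  exists (d : int) (c : {malg int[J]}), d != 0 /\ d%:~R *: x = malg_of_int rat c.
Proof.
elim/malg_ind: x => [|e x y [d [c [d0 dx]]] [d' [c' [d'0 dy]]]|j].
- by exists 1, 0; rewrite scaler0 raddf0.
- exists (denq e * d * d'), ((numq e * d') *: c + (denq e * d) *: c').
  split; first by rewrite !mulf_neq0 ?denq_neq0.
  rewrite malg_of_intP malg_of_intZ -scaler_int -dx -dy scalerDr !scalerA -!intrM.
  congr (_ *: _ + _ *: _).
  rewrite !intrM -{2}[e]divq_num_den [X in X = _]mulrC -!mulrA.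
  by field; rewrite intr_eq0 denq_neq0.
by exists 1, << j >>; rewrite malg_of_intU scale1r.
Qed.

Variables (p : nat) (p_prime : prime p).
Hypothesis a_free : linearly_independent (fun j => malg_of_int 'F_p (a j)).

(** Reducing an integral relation mod p gives the trivial relation, so p divides every coefficient;
    the quotient is again a relation because the free module is torsion-free. *)
Lemma malg_lift_int_div c : malg_lift a c = 0 ->
  exists c', c = p%:R *: c' /\ malg_lift a c' = 0.
Proof.
move=> c0; have p_dvd j : exists k : int, c@_j = p%:R * k.
  have /linearly_independentP a_inj := a_free.
  have := a_inj (malg_of_int 'F_p c); rewrite -malg_of_int_lift c0 raddf0.
  move=> /(_ erefl) /(congr1 (mcoeff j)); rewrite mcoeff0 malg_of_intE => cj0.
  have : (p %| c@_j)%Z.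
    by rewrite (dvdz_pcharf (pchar_Fp p_prime)) cj0.
  by move=> /dvdzP[k ->]; exists k; rewrite mulrC natz.
pose k j := projT1 (cid (p_dvd j)).
have kP j : c@_j = p%:R * k j by exact: projT2 (cid (p_dvd j)).
pose c' : {malg int[J]} := \sum_(j <- msupp c) << k j *g j >>.
have cE : c = p%:R *: c'.
  rewrite {1}[c]monalgE scaler_sumr; apply: eq_bigr => j _.
  by rewrite malgUZ [in RHS]malgUZ scalerA kP.
exists c'; split=> //; apply/malgP => i; rewrite mcoeff0.
move: c0; rewrite {1}cE linearZ => /(congr1 (mcoeff i)) /=.
rewrite mcoeffZ mcoeff0 => /eqP; rewrite mulf_eq0 => /orP[|/eqP //].
by rewrite Num.Theory.pnatr_eq0 gtn_eqF // prime_gt0.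
Qed.

(** Infinite descent: the division by p can be repeated forever, so each coefficient is divisible by
    all powers of p. *)
Lemma malg_lift_int_eq0 c : malg_lift a c = 0 -> c = 0.
Proof.
have p_pow n : forall c, malg_lift a c = 0 -> forall j, (p ^ n %| `|c@_j|)%N.
  elim: n => [|n IHn] {}c; first by move=> _ j; rewrite expn0 dvd1n.
  move=> /malg_lift_int_div[c' [-> /IHn IHc']] j.
  by rewrite mcoeffZ abszM natz expnS dvdn_mul.
move=> c0; apply/malgP => j; rewrite mcoeff0; apply/eqP; rewrite -absz_eq0.
(* The exponent n is the absolute value of the coefficient itself, since n < p^n contradicts
   divisibility of a nonzero n. *)
apply: contraTT (p_pow `|c@_j|%N _ c0 j); rewrite -lt0n => cj0.
by apply/negP => /(dvdn_leq cj0); rewrite leqNgt ltn_expl ?prime_gt1.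
Qed.

(** Clearing denominators turns a rational relation into an integral one. *)
Lemma rational_independence : linearly_independent (fun j => malg_of_int rat (a j)).
Proof.
apply/linearly_independentP => x x0.
have [d [c [d0 dx]]] := malg_common_denominator x.
have c0 : c = 0.
  apply: malg_lift_int_eq0; apply: (@malg_of_int_inj _ rat).
  by rewrite malg_of_int_lift -dx linearZ /= x0 scaler0 raddf0.
apply: (@scalerI _ _ d%:~R); first by rewrite intr_eq0.
by rewrite dx c0 raddf0 scaler0.
Qed.

End IntegralIndependence.

Section DivisibleTarget.
Local Open Scope group_scope.

(** Integral exponent sums, the common source of the rows mod p and of the rational rows. *)
Definition int_exponent (G : groupType) (I : choiceType) :
    {hom equation_word G I -> Algebra.to_multiplicative {malg int[I]}} :=
  substitute (@one_fun G _) (fun i => (<< i >>%R : Algebra.to_multiplicative {malg int[I]})).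

Lemma exponent_vector_int p (G : groupType) (I : choiceType) (u : equation_word G I) :
  exponent_vector p G I u = malg_of_int 'F_p (int_exponent G I u).
Proof.
rewrite exponent_vectorE; apply/esym.
pose phi : {hom Algebra.to_multiplicative {malg int[I]} ->
    Algebra.to_multiplicative {malg 'F_p[I]}} :=
  Algebra.to_fmultiplicative (malg_of_int 'F_p).
apply: (substitute_comp (phi := phi)) => [x|i]; first exact: gmulf1.
exact: malg_of_intU.
Qed.

Variables (D : groupType) (D_ab : abelian_group D) (V : lmodType rat).
Variable pi : {hom Algebra.to_multiplicative V -> D}.
Hypothesis pi_surj : forall d, exists v, pi v = d.

(** As [D] is abelian, substituting [x i = pi (g << i >>)] with [g] linear gives a word its value at
    trivial variables times [pi (g e)], where e is its exponent row. Since the rows are independent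
    over Q, [g] can be prescribed on them so as to cancel the constants. *)
Lemma divisible_solvable p (p_prime : prime p) (G : groupType) (iota : {hom G -> D})
    (I J : choiceType) (w : J -> equation_word G I) :
  p_nonsingular p w -> solvable_in iota w.
Proof.
move=> w_free; pose a j : {malg int[I]} := int_exponent G I (w j).
have a_free : linearly_independent (fun j => malg_of_int rat (a j)).
  apply: (rational_independence p_prime); move: w_free; rewrite /p_nonsingular.
  by congr linearly_independent; apply/funext => j; exact: exponent_vector_int.
pose const := substitute iota (fun _ : I => 1).
pose b j := projT1 (cid (pi_surj (const (w j))^-1)).
have bP j : pi (b j) = (const (w j))^-1 by exact: projT2 (cid (pi_surj _)).
have [g gab] := linear_extension b a_free.
pose x i := pi (g << i >>%R).
exists x => j; suff xE u : substitute iota x u =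
    const u * pi (g (malg_of_int rat (int_exponent G I u))).
  by rewrite xE -/(a j) gab bP mulgV.
pose phi : {hom Algebra.to_multiplicative {malg int[I]} -> D} :=
  pi \o Algebra.to_fmultiplicative (g \o malg_of_int rat).
rewrite -[pi _]/(phi (int_exponent G I u)).
elim/equation_word_ind: u => [|u v IHu IHv|u IHu|c|i].
- by rewrite !gmulf1 mulg1.
- rewrite !gmulfM IHu IHv -!mulgA; congr (_ * _).
  by rewrite !mulgA; congr (_ * _); apply: D_ab.
- by rewrite !gmulfV IHu invgM; apply: D_ab.
- by rewrite /const !substitute_coef /one_fun gmulf1 mulg1.
rewrite /const !substitute_var mul1g /x.
exact: (congr1 (fun v => pi (g v)) (esym (malg_of_intU _ i))).
Qed.

End DivisibleTarget.

(** A copy of [A] in additive notation, so that integral combinations of its elements are evaluated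
    by [malg_lift]. *)
Definition additive_group (A : groupType) of abelian_group A : Type := A.

Section AdditiveGroup.
Local Open Scope group_scope.
Variables (A : groupType) (A_ab : abelian_group A).
Notation B := (additive_group A_ab).
#[hnf] HB.instance Definition _ := Choice.on B.

Fact additive_groupC : commutative (@monoid.mul A : B -> B -> B).
Proof. exact: A_ab. Qed.
Fact additive_groupN :
  left_inverse (1 : A) (@monoid.inv A : B -> B) (@monoid.mul A : B -> B -> B).
Proof. exact: mulVg. Qed.
Fact additive_group0 : left_id (1 : A) (@monoid.mul A : B -> B -> B).
Proof. exact: mul1g. Qed.
Fact additive_groupA : associative (@monoid.mul A : B -> B -> B).
Proof. exact: mulgA. Qed.

HB.instance Definition _ := GRing.isZmodule.Build B
  additive_groupA additive_groupC additive_group0 additive_groupN.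

Lemma additive_group_natmul (x : B) n : (x *+ n)%R = ((x : A) ^+ n) :> A.
Proof. by elim: n => [|n IHn] //; rewrite mulrS expgS -IHn. Qed.

Definition evaluate : {malg int[A]} -> B :=
  malg_lift (fun a : A => (a : zmodule B)).

Lemma evaluate_linear c x y : evaluate (c *: x + y)%R = (evaluate x *~ c + evaluate y)%R.
Proof. exact: (linearP (malg_lift (fun a : A => (a : zmodule B)))). Qed.

Lemma evaluateU a : evaluate << a >>%R = a.
Proof. by rewrite /evaluate malg_liftU scale1r. Qed.

Lemma evaluate0 : evaluate 0%R = 0%R.
Proof. exact: (linear0 (malg_lift (fun a : A => (a : zmodule B)))). Qed.
End AdditiveGroup.

(** * Embedding an abelian group in a quotient of a rational vector space *)

Section DivisibleHull.
Local Open Scope group_scope.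
Variables (A : groupType) (A_ab : abelian_group A) (S : nat -> Prop).
Hypotheses (S1 : S 1) (SM : forall m n, S m -> S n -> S (m * n)%N).

Notation V := {malg rat[A]}.
Notation mV := (Algebra.to_multiplicative V).

(* For [S] = {1} this is the kernel of Z^(A) -> A; a larger [S] also kills the
   [S]-torsion that the quotient of Q^(A) would otherwise acquire. *)
Let hull_kernel (v : mV) : Prop := exists m (u : {malg int[A]}),
  [/\ S m, ((v : V) *+ m)%R = malg_of_int rat u & evaluate A_ab u = 0%R].

Let hull_kernel1 : hull_kernel 1.
Proof. by exists 1%N, 0%R; split; rewrite ?evaluate0 // mulr1n raddf0. Qed.

Let hull_kernelM x y : hull_kernel x -> hull_kernel y -> hull_kernel (x * y).
Proof.
move=> [m [u [Sm mx u0]]] [n [v [Sn ny v0]]].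
exists (m * n)%N, (n%:R *: u + m%:R *: v)%R; split; first exact: SM.
- rewrite malg_of_intP malg_of_intZ -scaler_int -mx -ny.
  rewrite [LHS](mulrnDl (m * n) (x : V) (y : V)); congr (_ + _)%R.
    by rewrite mulrnA natz -pmulrn scaler_nat.
  by rewrite mulnC mulrnA natz -pmulrn scaler_nat.
- rewrite evaluate_linear u0 mul0rz add0r -[(_ *: v)%R]addr0 evaluate_linear.
  by rewrite v0 mul0rz evaluate0 addr0.
Qed.

Let hull_kernelV x : hull_kernel x -> hull_kernel x^-1.
Proof.
move=> [m [u [Sm mx u0]]]; exists m, (-1 *: u + 0)%R; split=> //.
- by rewrite malg_of_intP raddf0 addr0 -mx mulrN1z -mulNrn.
- by rewrite evaluate_linear u0 evaluate0 mul0rz addr0.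
Qed.

Let K : groupClosed mV := prop_subgroup hull_kernel1 hull_kernelM hull_kernelV.
Let full : groupClosed mV :=
  @prop_subgroup mV (fun _ => True) I (fun _ _ _ _ => I) (fun _ _ => I).

Let in_full x : x \in full.
Proof. exact/in_prop_subgroup. Qed.

Let K_normal : normal_in full K.
Proof.
split=> [x _|x h xK _]; first exact: in_full.
by rewrite conjgE [X in _ * X]addrC [_ * _]addrA addNr add0r.
Qed.

(** Take Q^(A) modulo [hull_kernel]. That kernel is closed under division by elements of [S], which
    excludes [S]-torsion; solvability holds in any quotient of a rational space. *)
Lemma divisible_hull : exists (D : groupType) (j : {hom A -> D}),
  [/\ abelian_group D,
      forall (x : D) m, S m -> x ^+ m = 1 -> x = 1,
      (forall (a : A) m, S m -> a ^+ m = 1 -> a = 1) -> injective j &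
      forall p (G : groupType) (iota : {hom G -> D}) (I J : choiceType)
        (w : J -> equation_word G I),
        prime p -> p_nonsingular p w -> solvable_in iota w].
Proof.
pose D : groupType := factor_group K_normal.
pose pi : {hom mV -> D} := quotient_map K_normal in_full.
have pi1 v : pi v = 1 <-> hull_kernel v.
  rewrite quotient_map_eq1; split=> [/in_prop_subgroup //|kv].
  exact/in_prop_subgroup.
have pi_surj d : exists v, pi v = d by exact: quotient_map_surj.
have D_ab : abelian_group D.
  move=> x y; have [[v <-] [v' <-]] := (pi_surj x, pi_surj y).
  by rewrite /commute -!gmulfM; congr (pi _); exact: addrC.
pose j0 (a : A) : D := pi << a >>%R.
have j0M : {morph j0 : x y / x * y}.
  move=> x y; rewrite -gmulfM; apply: divg1_eq; rewrite -gmulfF.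
  apply/pi1; exists 1%N, (-1 *: (<< x >> + << y >>) + << (x * y)%g >>)%R; split=> //.
    rewrite malg_of_intP raddfD /= !malg_of_intU mulrN1z mulr1n.
    exact: addrC.
  rewrite evaluate_linear -[(<< x >>)%R]scale1r evaluate_linear !evaluateU.
  by rewrite mulrN1z mulr1z; exact: (@addNr (additive_group A_ab)).
have j01 : j0 1 = 1 by apply: (mulIg (j0 1)); rewrite -j0M !mul1g.
pose jU := isUMagmaMorphism.Build A D j0 (conj j01 j0M).
pose j : {hom A -> D} := HB.pack j0 jU.
have pi_pow v m : pi v ^+ m = pi ((v : V) *+ m)%R.
  by rewrite -gmulfXn.
exists D, j; split=> //.
- move=> x m Sm; have [v <-] := pi_surj x; rewrite pi_pow => /pi1[n [u [Sn vE u0]]].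
  by apply/pi1; exists (m * n)%N, u; rewrite mulrnA; split=> //; exact: SM.
- move=> A_tf; apply: gmulf_inj => a /pi1[m [u [Sm aE u0]]]; apply: (A_tf a m Sm).
  (* The kernel condition on the basis vector of [a] forces [u] to be m times that vector, and this
     evaluates to a^m. *)
  have uE : u = (m%:R *: << a >> + 0)%R.
    apply: (@malg_of_int_inj _ rat); rewrite -aE malg_of_intP raddf0 addr0.
    by rewrite malg_of_intU natz -pmulrn.
  move: u0; rewrite uE evaluate_linear evaluateU evaluate0 addr0 natz -pmulrn.
  by rewrite additive_group_natmul.
- by move=> p G iota I J w p_prime; exact: (divisible_solvable D_ab pi_surj p_prime).
Qed.

End DivisibleHull.

(** * Wreath products *)

(** Unrestricted wreath product: [base] is an arbitrary function, on whose argument tops act by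
    right translation. *)
Record wreath (H B : groupType) := Wreath { base : B -> H; top : B }.

Section WreathGroup.
Local Open Scope group_scope.
Variables H B : groupType.
Notation W := (wreath H B).

HB.instance Definition _ := gen_eqMixin W.
HB.instance Definition _ := gen_choiceMixin W.

Lemma wreath_ext (x y : W) : (forall q, base x q = base y q) -> top x = top y -> x = y.
Proof. by case: x y => [f a] [f' a'] /= /funext -> ->. Qed.

Definition wreath_mul (x y : W) : W :=
  Wreath (fun q => base x q * base y (q * top x)) (top x * top y).
Definition wreath_one : W := Wreath (fun _ => 1) 1.
Definition wreath_inv (x : W) : W :=
  Wreath (fun q => (base x (q / top x))^-1) (top x)^-1.

Lemma wreath_mulA : associative wreath_mul.
Proof. by move=> x y z; apply: wreath_ext => [q|] /=; rewrite !mulgA. Qed.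

Lemma wreath_mul1g : left_id wreath_one wreath_mul.
Proof. by move=> x; apply: wreath_ext => [q|] /=; rewrite ?mulg1 mul1g. Qed.

Lemma wreath_mulg1 : right_id wreath_one wreath_mul.
Proof. by move=> x; apply: wreath_ext => [q|] /=; rewrite mulg1. Qed.

Lemma wreath_mulVg : left_inverse wreath_one wreath_inv wreath_mul.
Proof. by move=> x; apply: wreath_ext => [q|] /=; rewrite mulVg. Qed.

Lemma wreath_mulgV : right_inverse wreath_one wreath_inv wreath_mul.
Proof. by move=> x; apply: wreath_ext => [q|] /=; rewrite ?mulgK mulgV. Qed.

HB.instance Definition _ := isGroup.Build W wreath_mulA wreath_mul1g wreath_mulg1
  wreath_mulVg wreath_mulgV.

Lemma topM : {morph @top H B : x y / x * y}.
Proof. by []. Qed.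

HB.instance Definition _ := isUMagmaMorphism.Build W B (@top H B) (conj erefl topM).

Lemma baseM (x y : W) q : base (x * y) q = base x q * base y (q * top x).
Proof. by []. Qed.

Lemma baseX (x : W) n q : top x = 1 -> base (x ^+ n) q = base x q ^+ n.
Proof.
by move=> x1; elim: n => [|n IHn] //; rewrite !expgS baseM x1 mulg1 IHn.
Qed.

End WreathGroup.

Section WreathMap.
Local Open Scope group_scope.
Variables (H K B : groupType) (phi : {hom H -> K}).

Definition wreath_map (x : wreath H B) : wreath K B :=
  Wreath (fun q => phi (base x q)) (top x).

Lemma wreath_mapM : {morph wreath_map : x y / x * y}.
Proof. by move=> x y; apply: wreath_ext => // q; rewrite /= gmulfM. Qed.

Lemma wreath_map1 : wreath_map 1 = 1.
Proof. by apply: wreath_ext => // q; rewrite /= gmulf1. Qed.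

HB.instance Definition _ := isUMagmaMorphism.Build (wreath H B) (wreath K B)
  wreath_map (conj wreath_map1 wreath_mapM).

End WreathMap.
Arguments wreath_map {H K} B phi x.

(** * Solving equations over a wreath product *)

Section WreathSolvable.
Local Open Scope group_scope.
Variables (p : nat) (p_prime : prime p) (H B : groupType).
Hypothesis B_ab : abelian_group B.
Hypothesis B_ptf : forall (x : B) m, coprime m p -> x ^+ m = 1 -> x = 1.
Hypothesis B_solvable : forall (G : groupType) (iota : {hom G -> B}) (I J : choiceType)
  (w : J -> equation_word G I), p_nonsingular p w -> solvable_in iota w.
Hypothesis H_solvable : forall (I J : choiceType) (w : J -> equation_word H I),
  p_nonsingular p w -> solvable_in (@idfun H) w.

Section Expansion.
Variables (I : choiceType) (b : I -> B).

(* A variable [x_i] over the wreath product is replaced by the element whose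
   [q]-th base coordinate is a new variable [(i, q)] over [H]; the base
   coordinates of an equation then become equations over [H]. *)
Definition wreath_expand : {hom equation_word (wreath H B) I ->
    wreath (equation_word H (I * B)%type) B} :=
  substitute (wreath_map B (coef_word H (I * B)%type))
    (fun i => Wreath (fun q => var_word H (i, q)) (b i)).

Lemma base_wreath_expand1 q : base (wreath_expand 1) q = 1.
Proof. by rewrite gmulf1. Qed.

Lemma base_wreath_expandM u v q : base (wreath_expand (u * v)) q =
  base (wreath_expand u) q * base (wreath_expand v) (q * top (wreath_expand u)).
Proof. by rewrite gmulfM. Qed.

Lemma base_wreath_expandV u q : base (wreath_expand u^-1) q =
  (base (wreath_expand u) (q / top (wreath_expand u)))^-1.
Proof. by rewrite gmulfV. Qed.

Lemma top_wreath_expand u : top (wreath_expand u) = substitute (@top H B) b u.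
Proof. by apply: (substitute_comp (phi := @top _ B)). Qed.

Lemma wreath_expand_substitute (h : I * B -> H) u :
  wreath_map B (substitute idfun h) (wreath_expand u) =
  substitute idfun (fun i => Wreath (fun q => h (i, q)) (b i)) u.
Proof.
apply: (substitute_comp (phi := wreath_map B (substitute idfun h))) => [x|i].
  by apply: wreath_ext => //= q; rewrite substitute_coef.
by apply: wreath_ext => //= q; rewrite substitute_var.
Qed.

Notation exps := (exponent_vector p H (I * B)%type).

(** Passing from coordinate 1 to coordinate [q] replaces each new variable (i, t) by (i, q t) and
    changes only coefficients besides, which do not contribute to exponents. *)
Lemma exponent_wreath_expand_translate u q :
  exps (base (wreath_expand u) q) =
  translate q (exps (base (wreath_expand u) 1) : {malg 'F_p[(I * B)%type]}).
Proof.
have tr_tr (r t : B) (x : {malg 'F_p[(I * B)%type]}) :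
    translate r (translate t x) = translate (r * t) x.
  elim/malg_ind: x => [|c x y IHx IHy|z]; first by rewrite !linear0.
    by rewrite !translateP IHx IHy.
  by rewrite /translate !malg_liftU !scale1r malg_liftU scale1r /= mulgA.
elim/equation_word_ind: u q => [|u v IHu IHv|u IHu|c|i] q.
- by rewrite !base_wreath_expand1 !gmulf1 linear0.
- rewrite !base_wreath_expandM !gmulfM mul1g IHu IHv (IHv (top _)).
  by rewrite [in RHS]raddfD /= tr_tr.
- rewrite !base_wreath_expandV !gmulfV IHu (IHu (1 / _)%g).
  by rewrite [in RHS]raddfN /= tr_tr mul1g.
- rewrite /wreath_expand substitute_coef /= !exponent_vectorE !substitute_coef.
  by rewrite /one_fun linear0.
rewrite /wreath_expand substitute_var /= !exponent_vectorE !substitute_var.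
by rewrite /translate malg_liftU scale1r /= mulg1.
Qed.

(** Forgetting the second index turns each new variable (i, t) back into the i-th original one. *)
Lemma exponent_wreath_expand_fiber_sum u q :
  fiber_sum (exps (base (wreath_expand u) q) : {malg 'F_p[(I * B)%type]}) =
  exponent_vector p _ I u.
Proof.
elim/equation_word_ind: u q => [|u v IHu IHv|u IHu|c|i] q.
- by rewrite !base_wreath_expand1 !gmulf1 linear0.
- by rewrite !base_wreath_expandM !gmulfM raddfD /= IHu IHv.
- by rewrite !base_wreath_expandV !gmulfV raddfN /= IHu.
- rewrite /wreath_expand substitute_coef /= !exponent_vectorE !substitute_coef.
  by rewrite /one_fun linear0.
rewrite /wreath_expand substitute_var /= !exponent_vectorE !substitute_var.
by rewrite /fiber_sum malg_liftU scale1r.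
Qed.

End Expansion.

(** With the tops of the unknowns fixed at a solution [b] in [B], their bases have to solve the
    system [w'] of all base coordinates. Its exponent rows are translates of rows whose fiber sums
    are the original exponent vectors, so [w'] is p-nonsingular. *)
Lemma wreath_solvable (I J : choiceType) (w : J -> equation_word (wreath H B) I) :
  p_nonsingular p w -> solvable_in (@idfun (wreath H B)) w.
Proof.
move=> w_free; have [b wb1] := B_solvable (@top H B) w_free.
pose w' (z : J * B) := base (wreath_expand b (w z.1)) z.2.
have w'_free : p_nonsingular p w'.
  have := translates_independent (I := I) (J := J) B_ab (pchar_Fp p_prime) B_ptf
    (w := fun j => exponent_vector p H (I * B)%type (base (wreath_expand b (w j)) 1)).
  have e : (fun j => fiber_sum (exponent_vector p H (I * B)%type
      (base (wreath_expand b (w j)) 1) : {malg 'F_p[(I * B)%type]})) =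
      (fun j => exponent_vector p _ I (w j) : {malg 'F_p[I]}).
    by apply/funext => j; exact: exponent_wreath_expand_fiber_sum.
  rewrite e => /(_ w_free); rewrite /p_nonsingular.
  congr linearly_independent; apply/funext => z.
  by rewrite /w' [in RHS]exponent_wreath_expand_translate.
have [h wh1] := H_solvable w'_free.
exists (fun i => Wreath (fun q => h (i, q)) (b i)) => j.
rewrite -wreath_expand_substitute; apply: wreath_ext => [q|].
  exact: (wh1 (j, q)).
by rewrite /= top_wreath_expand wb1.
Qed.

End WreathSolvable.

(** * Series *)

Section FactorCriteria.
Local Open Scope group_scope.

(** The form with exponents prime to p avoids orders and can be checked coordinatewise and in
    subgroups. *)
Lemma p'_torsion_freeP (p : nat) (B : groupType) : prime p ->
  p'_torsion_free p B <-> forall (x : B) m, coprime m p -> x ^+ m = 1 -> x = 1.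
Proof.
move=> p_prime; split=> [B_ptf x m m_p xm1|B_ptf x x1].
  apply: contrapT => x1; have m_gt0 : (0 < m)%N.
    rewrite lt0n; apply: contraTneq m_p => ->.
    by rewrite /coprime gcd0n gtn_eqF ?prime_gt1.
  have [x_inf|[k [_ xk k_min]]] := B_ptf x x1; first exact: x_inf xm1.
  have m_pk : coprime m (p ^ k) by rewrite coprimeXr.
  (* Bezout gives u m = v p^k + 1, so x is a product of powers of x^m and x^(p^k), both trivial or
     inverted. *)
  case: (egcdnP (p ^ k) m_gt0) => u v uv _; move: uv; rewrite (eqP m_pk) => uv.
  apply: x1; have : x ^+ (u * m) = 1 by rewrite mulnC expgnA xm1 expg1n.
  by rewrite uv expgnDr mulnC expgnA xk expg1n mul1g expg1.
have [[m [m_gt0 xm1]]|x_inf] := pselect (exists m, (0 < m)%N /\ x ^+ m = 1); last first.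
  by left=> m m_gt0 xm1; apply: x_inf; exists m.
right; pose Q m := (0 < m)%N && (x ^+ m == 1).
have exQ : exists m, Q m by exists m; rewrite /Q m_gt0 xm1 eqxx.
case: (ex_minnP exQ) => n /andP[n_gt0 /eqP xn1] n_min.
(* Write the order as n = k p^l with k prime to p. Then x^(p^l) is killed by k, hence trivial, and
   minimality of n makes p^l the order. *)
have [k k_p nE] := pfactor_coprime p_prime n_gt0.
have pk_gt0 : (0 < p ^ logn p n)%N by rewrite expn_gt0 prime_gt0.
exists (logn p n); split=> //; last first.
  move=> l /andP[l_gt0 l_lt] xl1; have : Q l by rewrite /Q l_gt0 xl1 eqxx.
  move=> /n_min; rewrite leqNgt; case/negP; apply: leq_trans l_lt _.
  by apply: dvdn_leq => //; exact: pfactor_dvdnn.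
apply: (B_ptf _ k); first by rewrite coprime_sym.
by rewrite -expgnA mulnC -nE.
Qed.

Variables (G : groupType) (H N : groupClosed G) (nNH : normal_in H N).

Lemma coset_eq1 (x : subgroup_of H) :
  (\pi_(factor_group nNH) x = 1)%qT <-> val x \in N.
Proof.
by split=> [/coset_eqP|xN]; last apply/coset_eqP; rewrite /= divg1.
Qed.

Definition coset_map (x : subgroup_of H) : factor_group nNH :=
  (\pi_(factor_group nNH) x)%qT.

Lemma coset_map1 : coset_map 1 = 1.
Proof. by apply/coset_eq1; rewrite gpred1. Qed.

HB.instance Definition _ := isUMagmaMorphism.Build (subgroup_of H)
  (factor_group nNH) coset_map (conj coset_map1 (coset_morphM nNH)).

Lemma factor_abelianP : abelian_group (factor_group nNH) <->
  {in H &, forall x y, [~ x, y] \in N}.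
Proof.
split=> [B_ab x y xH yH|H_ab x y].
  pose x' : subgroup_of H := exist _ x xH; pose y' : subgroup_of H := exist _ y yH.
  have /coset_eq1 : coset_map [~ x', y'] = 1.
    by rewrite gmulfR; apply/eqP/commgP; exact: B_ab.
  by rewrite gmulfR.
rewrite -[x]reprK -[y]reprK; apply/commgP.
rewrite -[[~ _, _]](gmulfR coset_map) -/(coset_map _); apply/eqP/coset_eq1.
by rewrite gmulfR; apply: H_ab; exact: valP.
Qed.

Lemma factor_ptfP (p : nat) : prime p -> p'_torsion_free p (factor_group nNH) <->
  {in H, forall x m, coprime m p -> x ^+ m \in N -> x \in N}.
Proof.
move=> p_prime; rewrite p'_torsion_freeP //; split=> [B_ptf x xH m m_p xmN|H_ptf x m m_p].
  pose x' : subgroup_of H := exist _ x xH.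
  have /coset_eq1 // : coset_map x' = 1.
  apply: (B_ptf _ m m_p); rewrite -gmulfXn; apply/coset_eq1.
  by rewrite gmulfXn.
rewrite -[x]reprK -[_ ^+ m](gmulfXn coset_map) => /coset_eq1; rewrite gmulfXn => xmN.
by apply/coset_eq1; apply: H_ptf m_p xmN; exact: valP.
Qed.

End FactorCriteria.

(** The hypotheses on the factors are restated through commutators and powers in [G], so that they
    transfer to subgroups and wreath products without handling factor groups. *)
Record tower (p n : nat) (G : groupType) (T : nat -> groupClosed G) : Prop := Tower {
  tower_normal : forall i, (i < n)%N -> normal_in (T i) (T i.+1);
  tower_first : forall x, x \in T 0%N;
  tower_last : forall x, (x \in T n) = (x == 1%g);
  tower_abelian : forall i, (i < n)%N ->
    {in T i &, forall x y, ([~ x, y] \in T i.+1)%g};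
  tower_ptf : forall i, (i.+1 < n)%N ->
    {in T i, forall x m, coprime m p -> (x ^+ m)%g \in T i.+1 -> x \in T i.+1}
}.

Section TowerSeries.
Variables (p n : nat) (p_prime : prime p) (G : groupType).

Lemma tower_of_series (s : subnormal_series G n) :
  (forall i : 'I_n, abelian_group (factor s i)) ->
  (forall i : 'I_n, (i.+1 < n)%N -> p'_torsion_free p (factor s i)) ->
  tower p n (term s).
Proof.
move=> s_ab s_ptf; split.
- by move=> i i_n; exact: (term_normal s (Ordinal i_n)).
- exact: term_first.
- exact: term_last.
- move=> i i_n; apply/(factor_abelianP (term_normal s (Ordinal i_n))).
  exact: s_ab.
- move=> i i_n; apply/(factor_ptfP (term_normal s (Ordinal (ltnW i_n))) p_prime).
  exact: s_ptf.
Qed.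

Lemma series_of_tower (T : nat -> groupClosed G) : tower p n T ->
  exists t : subnormal_series G n,
    (forall i : 'I_n, abelian_group (factor t i)) /\
    (forall i : 'I_n, (i.+1 < n)%N -> p'_torsion_free p (factor t i)).
Proof.
move=> T_tower; exists (SubnormalSeries (fun i : 'I_n => tower_normal T_tower (ltn_ord i))
  (tower_first T_tower) (tower_last T_tower)); split=> i.
  apply/(factor_abelianP (tower_normal T_tower (ltn_ord i))).
  exact: (tower_abelian T_tower).
move=> i_n; apply/(factor_ptfP (tower_normal T_tower (ltn_ord i)) p_prime).
exact: (tower_ptf T_tower).
Qed.

End TowerSeries.

Section WreathTower.
Local Open Scope group_scope.
Variables (p n : nat) (H B : groupType) (T : nat -> groupClosed H).
Hypotheses (T_tower : tower p n T) (n_gt0 : (0 < n)%N).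
Hypothesis B_ab : abelian_group B.
Hypothesis B_ptf : forall (x : B) m, coprime m p -> x ^+ m = 1 -> x = 1.

(** Term 0 is the whole wreath product and term i + 1 consists of the functions with values in
    [T i]; in particular term 1 is the base group. *)
Definition wreath_term_prop (i : nat) (x : wreath H B) : Prop :=
  if i is i'.+1 then top x = 1 /\ forall q, base x q \in T i' else True.

Lemma wreath_term1 i : wreath_term_prop i 1.
Proof. by case: i => [|i] //=; split=> // q; exact: gpred1. Qed.

Lemma wreath_termM i x y :
  wreath_term_prop i x -> wreath_term_prop i y -> wreath_term_prop i (x * y).
Proof.
case: i => [|i] //= [x1 xT] [y1 yT]; split=> [|q]; first by rewrite x1 y1 mulg1.
exact: gpredM.
Qed.

Lemma wreath_termV i x : wreath_term_prop i x -> wreath_term_prop i x^-1.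
Proof.
case: i => [|i] //= [x1 xT]; split=> [|q]; first by rewrite x1 invg1.
by rewrite gpredV.
Qed.

Definition wreath_term (i : nat) : groupClosed (wreath H B) :=
  prop_subgroup (wreath_term1 i) (@wreath_termM i) (@wreath_termV i).

Lemma in_wreath_term i x : reflect (wreath_term_prop i x) (x \in wreath_term i).
Proof. exact: in_prop_subgroup. Qed.

(** The first factor is [B]; each later one is a Cartesian power of a factor of [T], and its
    properties are checked coordinatewise. *)
Lemma wreath_tower : tower p n.+1 wreath_term.
Proof.
split.
- case=> [|i] i_n; split.
  + by move=> x _; exact/in_wreath_term.
  + move=> x y /in_wreath_term[x1 xT] _; apply/in_wreath_term; split=> [|q].
      by rewrite /= x1 mul1g mulVg.
    exact: tower_first T_tower _.
  + move=> x /in_wreath_term[x1 xT]; apply/in_wreath_term; split=> // q.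
    exact: (tower_normal T_tower i_n).1.
  move=> x y /in_wreath_term[x1 xT] /in_wreath_term[y1 yT].
  apply/in_wreath_term; split=> [|q]; first by rewrite /= x1 mul1g mulVg.
  rewrite /= x1 y1 !invg1 !mulg1.
  exact: (tower_normal T_tower i_n).2.
- by move=> x; exact/in_wreath_term.
- move=> x; apply/in_wreath_term/eqP => [[x1 xT]|->]; last first.
    by split=> // q; rewrite (tower_last T_tower) eqxx.
  apply: wreath_ext => // q; apply/eqP; rewrite -(tower_last T_tower); exact: xT.
- case=> [|i] i_n x y; last first.
    move=> /in_wreath_term[x1 xT] /in_wreath_term[y1 yT]; apply/in_wreath_term.
    split=> [|q]; first by rewrite /= x1 y1 !invg1 !mulg1.
    rewrite /= x1 y1 !invg1 !mulg1.
    exact: (tower_abelian T_tower).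
  move=> _ _; apply/in_wreath_term; split=> [|q]; last exact: tower_first T_tower _.
  by rewrite (gmulfR (@top H B)); apply/eqP/commgP; exact: B_ab.
case=> [|i] i_n x; last first.
  move=> /in_wreath_term[x1 xT] m m_p /in_wreath_term[_ xmT].
  apply/in_wreath_term; split=> // q; apply: (tower_ptf T_tower i_n (xT q) m_p).
  by rewrite -baseX.
move=> _ m m_p /in_wreath_term[xm1 _]; apply/in_wreath_term; split=> [|q].
  by apply: (B_ptf m_p); rewrite -(gmulfXn (@top H B)).
exact: tower_first T_tower _.
Qed.

End WreathTower.

Section SubgroupTower.
Variables (p n : nat) (G : groupType) (T : nat -> groupClosed G).
Hypothesis T_tower : tower p n.+1 T.
Notation N := (subgroup_of (T 1%N)).

Lemma sub_term1 i : val (1 : N)%g \in T i.+1.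
Proof. by rewrite gmulf1 gpred1. Qed.

Lemma sub_termM i (x y : N) : val x \in T i.+1 -> val y \in T i.+1 ->
  val (x * y)%g \in T i.+1.
Proof. by rewrite gmulfM; exact: gpredM. Qed.

Lemma sub_termV i (x : N) : val x \in T i.+1 -> val x^-1%g \in T i.+1.
Proof. by rewrite gmulfV gpredV. Qed.

(** The series of [G] from its second term on, with indices shifted by one. *)
Definition sub_term (i : nat) : groupClosed N :=
  prop_subgroup (sub_term1 i) (@sub_termM i) (@sub_termV i).

Lemma in_sub_term i x : (x \in sub_term i) = (val x \in T i.+1).
Proof. by apply/in_prop_subgroup/idP. Qed.

Lemma sub_tower : tower p n sub_term.
Proof.
split.
- move=> i i_n; have [sTT nTT] := tower_normal T_tower (i := i.+1) i_n.
  split=> [x|x y]; rewrite !in_sub_term; first exact: sTT.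
  by move=> xT yT; rewrite gmulfJ; exact: nTT.
- by move=> x; rewrite in_sub_term; exact: valP.
- by move=> x; rewrite in_sub_term (tower_last T_tower) -(inj_eq val_inj) gmulf1.
- move=> i i_n x y; rewrite !in_sub_term => xT yT; rewrite gmulfR.
  exact: (tower_abelian T_tower).
- move=> i i_n x; rewrite !in_sub_term => xT m m_p; rewrite in_sub_term gmulfXn.
  exact: (tower_ptf T_tower).
Qed.

End SubgroupTower.

(** * The Kaluzhnin-Krasner embedding *)

Section WreathEmbedding.
Local Open Scope group_scope.
Variables (G D H : groupType) (N : groupClosed G) (pi : {hom G -> D}).
Hypothesis piN : forall g, pi g = 1 <-> g \in N.
Variable iota : {hom subgroup_of N -> H}.

(** [pi] need not be onto, since [D] will be a divisible hull of the quotient, so a representative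
    is chosen in each left coset of its image. The default 1 of [xget] is never reached: the coset
    contains [q]. *)
Let left_coset (q : D) : set D := fun r => exists g, q = r * pi g.
Let rep (q : D) : D := xget 1 (left_coset q).

Let repP q : exists g, q = rep q * pi g.
Proof.
by apply: (xgetPex (P := left_coset q) 1); exists q, 1; rewrite gmulf1 mulg1.
Qed.

Let repM q g : rep (q * pi g) = rep q.
Proof.
congr (xget 1 _); apply/funext => r; apply/propext; split=> -[h qE].
  by exists (h / g); rewrite gmulfF mulgA -qE mulgK.
by exists (h * g); rewrite gmulfM mulgA -qE.
Qed.

(* As [rep] is constant on the left cosets of the image of [pi], the element
   [lift q * g / lift (q * pi g)] lies in the kernel of [pi]. *)
Let lift q := projT1 (cid (repP q)).

Let liftP q : q = rep q * pi (lift q).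
Proof. exact: projT2 (cid (repP q)). Qed.

Let cocycle_in g q : lift q * g / lift (q * pi g) \in N.
Proof.
apply/piN; rewrite gmulfF gmulfM; apply/eqP; rewrite divg_eq1; apply/eqP.
apply: (mulgI (rep q)); rewrite mulgA -liftP.
by rewrite {1}[LHS]liftP repM.
Qed.

Let cocycle g q : subgroup_of N :=
  exist _ (lift q * g / lift (q * pi g)) (cocycle_in g q).

Let embed (g : G) : wreath H D := Wreath (fun q => iota (cocycle g q)) (pi g).

(** The cocycles telescope: the factor for [x] at [q] ends with the inverse of the lift with which
    the factor for [y] at [q * pi x] begins. *)
Let embedM : {morph embed : x y / x * y}.
Proof.
move=> x y; apply: wreath_ext => [q|] /=; last exact: gmulfM.
rewrite -gmulfM; congr (iota _); apply: val_inj; rewrite [RHS]gmulfM /=.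
by rewrite gmulfM !mulgA mulgVK.
Qed.

Let embed1 : embed 1 = 1.
Proof. by apply: (mulIg (embed 1)); rewrite -embedM !mul1g. Qed.

(** If the image of [g] is trivial then [pi g = 1], so its base at 1 is [iota] of a conjugate of [g]
    by the inverse of [lift 1]; injectivity of [iota] gives g = 1. *)
Lemma wreath_embedding : injective iota ->
  exists j : {hom G -> wreath H D}, injective j.
Proof.
move=> iota_inj.
pose jU := isUMagmaMorphism.Build G (wreath H D) embed (conj embed1 embedM).
pose j : {hom G -> wreath H D} := HB.pack embed jU.
exists j; apply: gmulf_inj => g g1.
have pi1 : pi g = 1 by exact: (congr1 (@top H D) g1).
have : iota (cocycle g 1) = 1 by exact: (congr1 (fun x => base x 1) g1).
move=> /eqP; rewrite gmulf_eq1 // => /eqP gc1.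
have : val (cocycle g 1) = 1 by rewrite gc1 gmulf1.
rewrite /= pi1 mulg1 => /eqP; rewrite divg_eq1 => /eqP.
by rewrite -[RHS]mulg1 => /mulgI.
Qed.

End WreathEmbedding.

Definition self_solvable (p : nat) (G : groupType) : Prop :=
  forall (I J : choiceType) (w : J -> equation_word G I),
    p_nonsingular p w -> solvable_in (@idfun G) w.

Section Coefficients.
Local Open Scope group_scope.
Variables (p : nat) (G K : groupType) (iota : {hom G -> K}).

(** Pushing the coefficients along [iota] leaves the exponent vectors unchanged. *)
Lemma self_solvable_hom : self_solvable p K ->
  forall (I J : choiceType) (w : J -> equation_word G I),
    p_nonsingular p w -> solvable_in iota w.
Proof.
move=> K_solvable I J w w_free.
pose m : {hom equation_word G I -> equation_word K I} :=
  substitute (coef_word K I \o iota) (@var_word K I).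
have [] := K_solvable I J (fun j => m (w j)).
  move: w_free; rewrite /p_nonsingular; congr linearly_independent.
  apply/funext => j; rewrite !exponent_vectorE; apply/esym.
  apply: (substitute_comp (phi := substitute (@one_fun K (exponent_group p I))
    (@basis_vector p I))) => [x|i]; first by rewrite /= substitute_coef.
  exact: substitute_var.
move=> g gP; exists g => j; rewrite -[RHS](gP j); apply/esym.
apply: (substitute_comp (phi := substitute (@idfun K) g)) => [x|i].
  by rewrite /= substitute_coef.
exact: substitute_var.
Qed.

End Coefficients.

(** * Induction on the length of the series *)

Section Main.
Local Open Scope group_scope.
Variables (p : nat) (p_prime : prime p).

Lemma abelian_tower (D : groupType) : abelian_group D ->
  exists T : nat -> groupClosed D, tower p 1 T.
Proof.
move=> D_ab; pose P i (x : D) := if i is 0%N then True else x = 1.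
have P1 i : P i 1 by case: i.
have PM i x y : P i x -> P i y -> P i (x * y).
  by case: i => //= _ -> ->; rewrite mulg1.
have PV i x : P i x -> P i x^-1 by case: i => //= _ ->; rewrite invg1.
pose T i := prop_subgroup (P1 i) (@PM i) (@PV i).
have inT i x : reflect (P i x) (x \in T i) by exact: in_prop_subgroup.
exists T; split=> //.
- case=> // _; split=> [x _|x y /inT /= -> _]; apply/inT => //.
  by rewrite /= conj1g.
- by move=> x; apply/inT.
- by move=> x; apply/inT/eqP.
- by case=> // _ x y _ _; apply/inT/eqP/commgP; exact: D_ab.
Qed.

(** The induction carries solvability of systems over the new group itself, as [wreath_solvable]
    requires of the base group. *)
Lemma tower_embedding n (G : groupType) (T : nat -> groupClosed G) :
  tower p n.+1 T -> exists (K : groupType) (iota : {hom G -> K})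
      (T' : nat -> groupClosed K),
    [/\ injective iota, tower p n.+1 T' & self_solvable p K].
Proof.
elim: n G T => [|n IHn] G T T_tower.
  have G_ab : abelian_group G.
    move=> x y; apply/commgP; rewrite -(tower_last T_tower).
    by apply: (tower_abelian T_tower) => //; exact: (tower_first T_tower).
  (* The only factor is the last one and may have any torsion; [S] = {1} makes the embedding
     injective in every case. *)
  have [||D [j [D_ab _ j_inj D_solv]]] :=
    divisible_hull G_ab (S := fun m => m = 1%N) => //.
    by move=> m k -> ->.
  have [T' T'_tower] := abelian_tower D_ab.
  exists D, j, T'; split=> //; first by apply: j_inj => a _ ->.
  by move=> I J w; exact: D_solv.
have N_normal := tower_normal T_tower (ltn0Sn n.+1).
pose q := quotient_map N_normal (tower_first T_tower).
have B_ab : abelian_group (factor_group N_normal).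
  by apply/factor_abelianP; exact: (tower_abelian T_tower).
have B_ptf : p'_torsion_free p (factor_group N_normal).
  by apply/(factor_ptfP _ p_prime); exact: (tower_ptf T_tower).
(* With [S] the exponents prime to p the hull is p'-torsion-free, and the embedding remains
   injective because the first factor is p'-torsion-free. *)
have [||D [j [D_ab D_ptf j_inj D_solv]]] :=
  divisible_hull B_ab (S := fun m => coprime m p) => //.
- by rewrite /= coprime1n.
- by move=> m k m_p k_p; rewrite /= coprimeMl m_p.
have {}j_inj : injective j by apply: j_inj; exact/p'_torsion_freeP.
have [H [iota [T1 [iota_inj T1_tower H_solv]]]] := IHn _ _ (sub_tower T_tower).
pose pi : {hom G -> D} := j \o q.
have piN g : pi g = 1 <-> g \in T 1%N.
  rewrite -(quotient_map_eq1 N_normal (tower_first T_tower)) /pi /=.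
  split=> [jg1|g1]; first by apply: j_inj; rewrite gmulf1.
  by rewrite /q /= g1 gmulf1.
have [k k_inj] := wreath_embedding piN iota_inj.
exists (wreath H D), k, (wreath_term D T1); split=> //.
  by apply: wreath_tower => // x m; exact: D_ptf.
have D_solv' G' iota' I J w := @D_solv p G' iota' I J w p_prime.
move=> I J w; exact: (wreath_solvable p_prime D_ab D_ptf D_solv' H_solv).
Qed.

End Main.

Theorem mainTheorem1 (p n : nat) (p_prime : prime p) (n_ge1 : (1 <= n)%N)
    (G : groupType) (s : subnormal_series G n)
    (s_abelian : forall i : 'I_n, abelian_group (factor s i))
    (s_ptf : forall i : 'I_n, (i.+1 < n)%N -> p'_torsion_free p (factor s i)) :
  exists (Ghat : groupType) (iota : {hom G -> Ghat})
         (t : subnormal_series Ghat n),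
    injective iota /\
    (forall i : 'I_n, abelian_group (factor t i)) /\
    (forall i : 'I_n, (i.+1 < n)%N -> p'_torsion_free p (factor t i)) /\
    (forall (I J : choiceType) (w : J -> equation_word G I),
       p_nonsingular p w -> solvable_in iota w) /\
    (forall (I J : choiceType) (w : J -> equation_word Ghat I),
       p_nonsingular p w -> solvable_in (@idfun Ghat) w).
Proof.
case: n n_ge1 s s_abelian s_ptf => // n _ s s_ab s_ptf.
have [K [iota [T [iota_inj T_tower K_solv]]]] :=
  tower_embedding p_prime (tower_of_series p_prime s_ab s_ptf).
have [t [t_ab t_ptf]] := series_of_tower p_prime T_tower.
exists K, iota, t; do 4!split=> //.
exact: self_solvable_hom.
Qed.
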